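(* Let $E$ be a complex JB$^*$-triple, $X$ a Banach triple $E$-module, and let $\delta:E\to X$ be a triple derivation. Then $\delta$ is continuous if and only if $\mathrm{Ann}_E(\sigma_X(\delta))$ is a (norm-closed) linear subspace of $E$ and $$\{\mathrm{Ann}_E(\sigma_X(\delta)),\mathrm{Ann}_E(\sigma_X(\delta)),\sigma_X(\delta)\}=0$$ in the triple split null extension $E\oplus X$ (that is, $\{a,b,x\}=0$ for all $a,b\in\mathrm{Ann}_E(\sigma_X(\delta))$ and $x\in\sigma_X(\delta)$).
   Context: A complex (resp. real) Jordan triple is a complex (resp. real) vector space $E$ with a triple product $\{\cdot,\cdot,\cdot\}:E^3\to E$, bilinear and symmetric in the outer variables and conjugate linear (resp. linear) in the middle one, with $L(a,b)L(x,y)-L(x,y)L(a,b)=L(L(a,b)x,y)-L(x,L(b,a)y)$, where $L(x,y)z=\{x,y,z\}$. It is a Jordan Banach triple if it is a Banach space with continuous triple product. A (complex) JB$^*$-triple is a complex Jordan Banach triple $E$ such that each $L(a,a)$ is a hermitian operator with non-negative spectrum and $\|\{a,a,a\}\|=\|a\|^3$. A triple $E$-module over a complex (resp. real) Jordan triple $E$ is a vector space $X$ with mappings $\{\cdot,\cdot,\cdot\}_1:X\times E\times E\to X$, $\{\cdot,\cdot,\cdot\}_2:E\times X\times E\to X$, $\{\cdot,\cdot,\cdot\}_3:E\times E\times X\to X$ such that: (JTM1) $\{x,a,b\}_1$ is linear in $a,x$ and conjugate linear in $b$ (resp. trilinear), $\{a,b,x\}_3$ is linear in $b,x$ and conjugate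 linear in $a$ (resp. trilinear), $\{a,x,b\}_2$ is conjugate linear in $a,b,x$ (resp. trilinear); (JTM2) $\{x,b,a\}_1=\{a,b,x\}_3$ and $\{a,x,b\}_2=\{b,x,a\}_2$; (JTM3) writing $\{\cdot,\cdot,\cdot\}$ for any of the products, $\{a,b,\{c,d,e\}\}=\{\{a,b,c\},d,e\}-\{c,\{b,a,d\},e\}+\{c,d,\{a,b,e\}\}$ whenever one of $a,b,c,d,e$ is in $X$ and the rest are in $E$. If $E$ is a Jordan Banach triple, $X$ is a Banach space and the three products are jointly continuous, $X$ is a Banach triple $E$-module. The triple split null extension is $E\oplus X$ with product $\{a_1+x_1,a_2+x_2,a_3+x_3\}=\{a_1,a_2,a_3\}+\{x_1,a_2,a_3\}+\{a_1,x_2,a_3\}+\{a_1,a_2,x_3\}$. A triple derivation from a complex (resp. real) Jordan triple $E$ to a triple $E$-module $X$ is a conjugate linear (resp. linear) map $\delta:E\to X$ (not assumed continuous) with $\delta\{a,b,c\}=\{\delta(a),b,c\}+\{a,\delta(b),c\}+\{a,b,\delta(c)\}$. The separating space of a linear (or conjugate linear) $T:X_1\to X_2$ between normed spaces is $\sigma_{X_2}(T)=\{z\in X_2:\exists (x_n)\subseteq X_1,\ x_n\to0,\ T(x_n)\to z\}$. For a triple $E$-module $X$ and $S\subseteq X$ a triple submodule (a subspace with $\{E,E,S\}\subseteq S$ and $\{E,S,E\}\subseteq S$; $\sigma_X(\delta)$ is one), the quadratic annihilator is $\mathrm{Ann}_E(S)=\{a\in E:\{a,s,a\}=0\ \forall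 s\in S\}$. *)

(* Defs.v *)
From HB Require Import structures.
From mathcomp Require Export all_boot all_order all_algebra.
From mathcomp Require Export all_classical all_reals all_analysis.
From mathcomp Require Export complex.

Set Implicit Arguments.
Unset Strict Implicit.
Unset Printing Implicit Defensive.

Import Order.TTheory GRing.Theory Num.Theory.
Import numFieldNormedType.Exports.

Local Open Scope classical_set_scope.
Local Open Scope ring_scope.

Notation conj_linear f := (linear_for (@Num.conj _ \; *:%R) f).

Record jordan_triple (R : realType) (E : lmodType R[i])
    (tp : E -> E -> E -> E) : Prop := {
  jt_linear_l : forall b c, linear (fun a => tp a b c) ;
  jt_conj_m : forall a c, conj_linear (fun b => tp a b c) ;
  jt_linear_r : forall a b, linear (fun c => tp a b c) ;
  jt_sym : forall a b c, tp a b c = tp c b a ;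
  jt_identity : forall a b x y z,
    tp a b (tp x y z) - tp x y (tp a b z) =
    tp (tp a b x) y z - tp x (tp b a y) z }.

Record jordan_banach_triple (R : realType) (E : completeNormedModType R[i])
    (tp : E -> E -> E -> E) : Prop := {
  jbt_jordan : jordan_triple tp ;
  jbt_continuous : continuous (fun p : E * E * E => tp p.1.1 p.1.2 p.2) }.

(* The three definitions below are meant for bounded linear T. For such T the
   exponential series converges in operator norm, hence pointwise, so the
   pointwise limit is the usual exponential. *)
Definition op_exp (R : realType) (E : completeNormedModType R[i])
    (T : E -> E) (x : E) : E :=
  limn (series (fun k => (k`!%:R : R[i])^-1 *: iter k T x)).

(* exp(itT) is an isometry for every real t; (0 +i* t) is the scalar it. *)
Definition hermitian_op (R : realType) (E : completeNormedModType R[i])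
    (T : E -> E) : Prop :=
  forall (t : R) (x : E),
    `|op_exp (fun y => (0 +i* t)%C *: T y) x| = `|x|.

Definition op_spectrum (R : realType) (E : completeNormedModType R[i])
    (T : E -> E) : set R[i] :=
  [set l | ~ exists S : E -> E,
     [/\ linear S, continuous S,
         cancel (fun x => T x - l *: x) S & cancel S (fun x => T x - l *: x)]].

(* In R[i] the order relation 0 <= l says that l is real and nonnegative. *)
Record JBstar_triple (R : realType) (E : completeNormedModType R[i])
    (tp : E -> E -> E -> E) : Prop := {
  jbs_banach : jordan_banach_triple tp ;
  jbs_hermitian : forall a, hermitian_op (tp a a) ;
  jbs_spectrum : forall a l, op_spectrum (tp a a) l -> 0 <= l ;
  jbs_norm : forall a, `|tp a a a| = `|a| ^+ 3 }.

(* m1, m2, m3 are the products with the module element in first, second and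
   third position. The middle product is conjugate linear in all three
   variables. The last five fields are the main identity
   {a,b,{c,d,e}} = {{a,b,c},d,e} - {c,{b,a,d},e} + {c,d,{a,b,e}}
   with the module element x in the place of a, b, c, d, e respectively. *)
Record triple_module (R : realType) (E X : lmodType R[i])
    (tp : E -> E -> E -> E)
    (m1 : X -> E -> E -> X) (m2 : E -> X -> E -> X) (m3 : E -> E -> X -> X)
    : Prop := {
  tm1_linear_x : forall a b, linear (fun x => m1 x a b) ;
  tm1_linear_a : forall x b, linear (fun a => m1 x a b) ;
  tm1_conj_b : forall x a, conj_linear (fun b => m1 x a b) ;
  tm2_conj_a : forall x b, conj_linear (fun a => m2 a x b) ;
  tm2_conj_x : forall a b, conj_linear (fun x => m2 a x b) ;
  tm2_conj_b : forall a x, conj_linear (fun b => m2 a x b) ;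
  tm3_conj_a : forall b x, conj_linear (fun a => m3 a b x) ;
  tm3_linear_b : forall a x, linear (fun b => m3 a b x) ;
  tm3_linear_x : forall a b, linear (fun x => m3 a b x) ;
  tm_sym13 : forall x a b, m1 x b a = m3 a b x ;
  tm_sym2 : forall x a b, m2 a x b = m2 b x a ;
  tm_id_a : forall x b c d e,
    m1 x b (tp c d e) =
    m1 (m1 x b c) d e - m2 c (m2 b x d) e + m3 c d (m1 x b e) ;
  tm_id_b : forall a x c d e,
    m2 a x (tp c d e) =
    m1 (m2 a x c) d e - m2 c (m1 x a d) e + m3 c d (m2 a x e) ;
  tm_id_c : forall a b x d e,
    m3 a b (m1 x d e) =
    m1 (m3 a b x) d e - m1 x (tp b a d) e + m1 x d (tp a b e) ;
  tm_id_d : forall a b c x e,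
    m3 a b (m2 c x e) =
    m2 (tp a b c) x e - m2 c (m3 b a x) e + m2 c x (tp a b e) ;
  tm_id_e : forall a b c d x,
    m3 a b (m3 c d x) =
    m3 (tp a b c) d x - m3 c (tp b a d) x + m3 c d (m3 a b x) }.

Record banach_triple_module (R : realType) (E X : completeNormedModType R[i])
    (tp : E -> E -> E -> E)
    (m1 : X -> E -> E -> X) (m2 : E -> X -> E -> X) (m3 : E -> E -> X -> X)
    : Prop := {
  btm_module : triple_module tp m1 m2 m3 ;
  btm_continuous1 : continuous (fun p : X * E * E => m1 p.1.1 p.1.2 p.2) ;
  btm_continuous2 : continuous (fun p : E * X * E => m2 p.1.1 p.1.2 p.2) ;
  btm_continuous3 : continuous (fun p : E * E * X => m3 p.1.1 p.1.2 p.2) }.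

Definition split_null_ext (R : realType) (E X : lmodType R[i])
    (tp : E -> E -> E -> E)
    (m1 : X -> E -> E -> X) (m2 : E -> X -> E -> X) (m3 : E -> E -> X -> X)
    (p q r : E * X) : E * X :=
  (tp p.1 q.1 r.1, m1 p.2 q.1 r.1 + m2 p.1 q.2 r.1 + m3 p.1 q.1 r.2).

Record triple_derivation (R : realType) (E X : lmodType R[i])
    (tp : E -> E -> E -> E)
    (m1 : X -> E -> E -> X) (m2 : E -> X -> E -> X) (m3 : E -> E -> X -> X)
    (delta : E -> X) : Prop := {
  td_conj_linear : conj_linear delta ;
  td_derivation : forall a b c,
    delta (tp a b c) =
    m1 (delta a) b c + m2 a (delta b) c + m3 a b (delta c) }.

Definition separating_space (R : realType) (X1 X2 : normedModType R[i])
    (T : X1 -> X2) : set X2 :=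
  [set z | exists u : nat -> X1,
     u @ \oo --> (0 : X1) /\ (fun n => T (u n)) @ \oo --> z].

Definition quad_annihilator (R : realType) (E X : lmodType R[i])
    (m2 : E -> X -> E -> X) (S : set X) : set E :=
  [set a | forall s, S s -> m2 a s a = 0].

Definition linear_subspace (R : realType) (E : lmodType R[i]) (A : set E) :
  Prop := submod_closed (mem A).

(* Main.v *)
(* If delta is continuous, its separating space S is 0 and Ann(S) = E.

   Conversely let J = Ann(S), with Q(a) x = {a,x,a}. A Baire argument bounds delta modulo
   S. The fundamental formula and cube roots make J a closed ideal, and delta is bounded
   on J because every element of J is a cube of an element of J. It remains to see that
   J = E.

   On the closed subtriple generated by a, ||x^3|| = ||x||^3 and the spectral condition
   give ||p(a)|| <= sup |p| on [0,||a||] for odd real polynomials p: this is proved for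
   the norms of multiplication operators, which satisfy a C*-identity, by factoring
   c^2 - p^2 over the complex numbers. Hence cube roots, and for each l a decomposition
   a^3 - l a = f - g with f^3 and g orthogonal.

   A gliding hump shows that no infinite sequence of orthogonal elements avoids J. If J
   were proper, some e outside J could therefore not be split by orthogonal elements
   outside J of its inner ideal; then every x there satisfies x^3 = l x modulo J for some
   real l >= 0. After scaling, e^3 = e modulo J, and comparing these cubic relations for
   h + l e with h self-adjoint yields Q(e) E in C e + J. So delta o Q(e) is bounded, which
   forces Q(e) S = 0, that is e in J. *)

(* Congruences modulo [J] stand in for the quotient E/J throughout. Modulo [J] the element e acts as
   a minimal tripotent, and the relation x^3 = l x says that x has at most one nonzero singular
   value there.

   The conditions on [J] enter at different places. Additivity allows Q to be polarised, so that the
   fundamental formula yields statements about full triple products. The condition on {J,J,S} takes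
   care of the outer terms in delta(c^3) = 2{c,c,delta c} + {c,delta c,c}; the definition of the
   annihilator speaks only of the inner one. Closedness puts limits of odd polynomials back into [J]
   and keeps e at a positive distance from it.

   A triple has only odd powers of an element. Writing odd functions as t p(t^2) turns the
   polynomials p in u = t^2 into multiplication operators, with u acting as L(a,a), the operator
   whose spectrum is controlled by hypothesis. Positive parts and cube roots then come from explicit
   polynomial iterations with uniform error bounds.

   Several of the maps are only conjugate linear, so boundedness is derived from homogeneity under
   real scalars. *)
From HB Require Import structures.
Require Import Defs.
From mathcomp Require Import ring lra zify.
Set Implicit Arguments.
Unset Strict Implicit.
Unset Printing Implicit Defensive.
Import Order.TTheory GRing.Theory Num.Theory.
Import numFieldNormedType.Exports.
Local Open Scope classical_set_scope.
Local Open Scope ring_scope.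
Local Open Scope complex_scope.

(** * The norm as a real number *)

Section RealNorm.
Variable R : realType.

Lemma ge0_complexE (z : R[i]) : 0 <= z -> z = (complex.Re z)%:C.
Proof. by case: z => a b; rewrite lecE /= => /andP[/eqP ->]. Qed.

(** The norm of a space over [R[i]] has values in [R[i]]; its real part lets the estimates be closed
    by [lra] and [nra]. *)
Definition nrm (V : normedModType R[i]) (x : V) : R := complex.Re `|x|.

Section Theory.
Variable V : normedModType R[i].
Implicit Types (x y : V) (u v : nat -> V).

Lemma nrmE x : `|x| = (nrm x)%:C.
Proof. exact: (ge0_complexE (normr_ge0 x)). Qed.

Lemma nrm_ge0 x : 0 <= nrm x.
Proof. by rewrite -ler0c -nrmE. Qed.

Lemma nrmD x y : nrm (x + y) <= nrm x + nrm y.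
Proof. by rewrite -lecR rmorphD /= -!nrmE ler_normD. Qed.

Lemma nrmN x : nrm (- x) = nrm x.
Proof. by rewrite /nrm normrN. Qed.

Lemma nrm0 : nrm (0 : V) = 0.
Proof. by rewrite /nrm normr0. Qed.

Lemma nrm0_eq0 x : nrm x = 0 -> x = 0.
Proof. by move=> h; apply/normr0_eq0; rewrite nrmE h. Qed.

Lemma nrm_distC x y : nrm (x - y) = nrm (y - x).
Proof. by rewrite -nrmN opprB. Qed.

Lemma nrmB x y : nrm (x - y) <= nrm x + nrm y.
Proof. by rewrite -[nrm y]nrmN; exact: nrmD. Qed.

Lemma nrm_triangle y x z : nrm (x - z) <= nrm (x - y) + nrm (y - z).
Proof. by rewrite -[x - z](subrKA y); exact: nrmD. Qed.

Lemma nrmZ (c : R[i]) x : nrm (c *: x) = complex.Re `|c| * nrm x.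
Proof.
rewrite /nrm normrZ [`|x|]nrmE (ge0_complexE (normr_ge0 c)).
by rewrite -rmorphM.
Qed.

Lemma nrmZR (r : R) x : nrm (r%:C *: x) = `|r| * nrm x.
Proof. by rewrite nrmZ normc_def /= expr0n addr0 sqrtr_sqr. Qed.

Lemma nrmMn x n : nrm (x *+ n) = n%:R * nrm x.
Proof.
rewrite -[x *+ n](scaler_nat n x) -[n%:R in LHS](rmorph_nat (real_complex R)) nrmZR.
by rewrite normr_nat.
Qed.

Definition tends u x := forall e : R, 0 < e -> exists N, forall n, (N <= n)%N -> nrm (u n - x) < e.

Lemma tendsP u x : tends u x <-> (u @ \oo --> x).
Proof.
split=> h.
  apply/cvgrPdist_lt => e e0.
  have [r0 er] : 0 < complex.Re e /\ e = (complex.Re e)%:C.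
    by split; [move: e0; rewrite ltcE => /andP[] | exact/ge0_complexE/ltW].
  have [N hN] := h _ r0; exists N => // n /= Nn.
  by rewrite distrC nrmE er ltcR; exact: hN.
move=> e e0.
have e0' : 0 < e%:C by rewrite ltcR.
move/cvgrPdist_lt : h => /(_ _ e0') [N _ hN]; exists N => n Nn.
by have := hN n Nn; rewrite /= distrC nrmE ltcR.
Qed.

Lemma tends_uniq u x y : tends u x -> tends u y -> x = y.
Proof.
move=> hx hy; apply/subr0_eq/nrm0_eq0/eqP; rewrite eq_le nrm_ge0 andbT.
apply/ler_addgt0Pr => e e0; rewrite add0r.
have e2 : 0 < e / 2 by lra.
have [N hN] := hx _ e2; have [M hM] := hy _ e2.
have := hN _ (leq_maxl N M); have := hM _ (leq_maxr N M).
have := nrm_triangle (u (maxn N M)) x y.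
rewrite (nrm_distC x (u _)); lra.
Qed.

Lemma tends_cst x : tends (fun _ => x) x.
Proof. by move=> e e0; exists 0%N => n _; rewrite subrr nrm0. Qed.

Lemma tendsD u v x y : tends u x -> tends v y -> tends (fun n => u n + v n) (x + y).
Proof.
move=> hx hy e e0; have e2 : 0 < e / 2 by lra.
have [N hN] := hx _ e2; have [M hM] := hy _ e2.
exists (maxn N M) => n; rewrite geq_max => /andP[/hN a /hM b].
rewrite opprD addrACA; have := nrmD (u n - x) (v n - y); lra.
Qed.

Lemma tendsN u x : tends u x -> tends (fun n => - u n) (- x).
Proof.
move=> hx e /hx [N hN]; exists N => n /hN.
by rewrite -opprD nrmN.
Qed.

Lemma tendsB u v x y : tends u x -> tends v y -> tends (fun n => u n - v n) (x - y).
Proof. by move=> hx hy; apply: tendsD => //; exact: tendsN. Qed.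

Lemma tends_scale c u x : tends u x -> tends (fun n => c *: u n) (c *: x).
Proof.
move=> hx e e0.
have c0 : 0 <= complex.Re `|c|.
  by have := normr_ge0 c; rewrite lecE => /andP[].
have d0 : 0 < e / (complex.Re `|c| + 1) by rewrite divr_gt0 //; lra.
have [N hN] := hx _ d0; exists N => n /hN.
rewrite -scalerBr nrmZ ltr_pdivlMr; last lra.
have := nrm_ge0 (u n - x); nra.
Qed.

Lemma tends_shift k u x : tends u x -> tends (fun n => u (n + k)%N) x.
Proof. by move=> hx e /hx [N hN]; exists N => n Nn; apply: hN; lia. Qed.

Lemma tends_le_nrm u x c : tends u x -> (forall n, nrm (u n) <= c) -> nrm x <= c.
Proof.
move=> hx hc; apply/ler_addgt0Pr => e e0.
have [N /(_ N (leqnn _)) h] := hx _ e0.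
have := nrm_triangle (u N) x 0; rewrite !subr0 (nrm_distC x).
have := hc N; lra.
Qed.

Definition ncauchy u := forall e : R, 0 < e ->
  exists N, forall m n, (N <= m)%N -> (N <= n)%N -> nrm (u m - u n) < e.

Lemma closed_tends (A : set V) u x : closed A -> (forall n, A (u n)) -> tends u x -> A x.
Proof.
move=> cA Au /tendsP ux; apply: (@closed_cvg _ _ _ _ u A cA) ux => //.
exact: nearW.
Qed.

End Theory.

Lemma ncauchy_tends (V : completeNormedModType R[i]) (u : nat -> V) :
  ncauchy u -> exists x, tends u x.
Proof.
move=> h; suff /cvg_ex[x ux] : cvgn u by exists x; apply/tendsP.
apply/cauchy_cvgP/cauchy_ballP => e e0.
have [r0 er] : 0 < complex.Re e /\ e = (complex.Re e)%:C.
  by split; [move: e0; rewrite ltcE => /andP[] | exact/ge0_complexE/ltW].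
have [N hN] := h _ r0.
rewrite near_map2; exists ([set n | (N <= n)%N], [set n | (N <= n)%N]); first by split; exists N.
move=> [m n] /= [Nm Nn].
by rewrite -ball_normE /ball_ /= nrmE er ltcR; exact: hN.
Qed.

Lemma continuous_tends (V W : normedModType R[i]) (f : V -> W) u x :
  {for x, continuous f} -> tends u x -> tends (fun n => f (u n)) (f x).
Proof. by move=> cf /tendsP ux; apply/tendsP; apply: continuous_cvg. Qed.

End RealNorm.

(** * Continuity and boundedness of homogeneous maps *)

Section Bounded.
Variable R : realType.

Lemma near0_nrm (V : normedModType R[i]) (P : set V) :
  nbhs (0 : V) P -> exists2 r : R, 0 < r & forall x, nrm x < r -> P x.
Proof.
move=> /nbhs_ballP[e /= e0 he]; exists (complex.Re e).
  by move: e0; rewrite ltcE => /andP[].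
move=> x xe; apply: he; rewrite -ball_normE /ball_ /= sub0r normrN nrmE.
by rewrite (ge0_complexE (ltW e0)) ltcR.
Qed.

Lemma homogeneous_bounded (V W : normedModType R[i]) (f : V -> W) :
  (forall (r : R) x, f (r%:C *: x) = r%:C *: f x) -> {for 0, continuous f} ->
  exists2 K : R, 0 < K & forall x, nrm (f x) <= K * nrm x.
Proof.
move=> fZ cf.
have f0 : f 0 = 0 by have := fZ 0 0; rewrite !scale0r.
have /near0_nrm[r r0 hr] : \forall x \near (0 : V), `|f 0 - f x| < 1.
  by move/cvgrPdist_lt : cf; apply.
exists (2 / r); first by rewrite divr_gt0.
move=> x; have [/eqP x0|x0] := eqVneq (nrm x) 0.
  by move/eqP : x0 => /nrm0_eq0 ->; rewrite f0 !nrm0 mulr0.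
have xp : 0 < nrm x by rewrite lt_def x0 nrm_ge0.
have s0 : 0 <= r / 2 / nrm x by rewrite ltW // !divr_gt0.
have : nrm ((r / 2 / nrm x)%:C *: x) < r.
  rewrite nrmZR ger0_norm //.
  by rewrite divfK // ltr_pdivrMr // ltr_pMr //; lra.
move=> /hr; rewrite f0 sub0r normrN nrmE (ltcR _ 1) fZ nrmZR => /ltW.
rewrite ger0_norm //.
rewrite mulrAC ler_pdivrMr // mul1r => h.
have := ler_wpM2l (ltW (divr_gt0 (ltr0Sn R 1) r0)) h.
rewrite mulrA (_ : 2 / r * (r / 2) = 1) ?mul1r //.
by field; rewrite gt_eqF.
Qed.

Lemma trihomogeneous_bounded (A B C D : normedModType R[i]) (f : A -> B -> C -> D) :
  (forall (r : R) a b c, f (r%:C *: a) b c = r%:C *: f a b c) ->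
  (forall (r : R) a b c, f a (r%:C *: b) c = r%:C *: f a b c) ->
  (forall (r : R) a b c, f a b (r%:C *: c) = r%:C *: f a b c) ->
  continuous (fun p : A * B * C => f p.1.1 p.1.2 p.2) ->
  exists2 K : R, 0 < K & forall a b c, nrm (f a b c) <= K * nrm a * nrm b * nrm c.
Proof.
move=> fa fb fc cf.
have f0a b c : f 0 b c = 0 by have := fa 0 0 b c; rewrite !scale0r.
have f0b a c : f a 0 c = 0 by have := fb 0 a 0 c; rewrite !scale0r.
have f0c a b : f a b 0 = 0 by have := fc 0 a b 0; rewrite !scale0r.
have : \forall p \near (0 : A * B * C), `|f 0 0 0 - f p.1.1 p.1.2 p.2| < 1.
  by have /cvgrPdist_lt := cf 0; apply.
move=> /nbhs_ballP[e /= e0 he].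
set r := complex.Re e.
have r0 : 0 < r by move: e0; rewrite ltcE => /andP[].
have er : e = r%:C by exact/ge0_complexE/ltW.
have hr a b c : nrm a < r -> nrm b < r -> nrm c < r -> nrm (f a b c) < 1.
  move=> ha hb hc; have := he (a, b, c); rewrite f0a sub0r normrN nrmE (ltcR _ 1).
  apply; split => /=; first split => /=.
  - by rewrite -ball_normE /ball_ /= sub0r normrN nrmE er ltcR.
  - by rewrite -ball_normE /ball_ /= sub0r normrN nrmE er ltcR.
  - by rewrite -ball_normE /ball_ /= sub0r normrN nrmE er ltcR.
have s0 (V : normedModType R[i]) (x : V) : nrm x != 0 -> 0 <= r / 2 / nrm x.
  by move=> x0; rewrite ltW // !divr_gt0 // lt_def x0 nrm_ge0.
have unit_sc (V : normedModType R[i]) (x : V) : nrm x != 0 -> nrm ((r / 2 / nrm x)%:C *: x) < r.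
  move=> x0; have xp : 0 < nrm x by rewrite lt_def x0 nrm_ge0.
  rewrite nrmZR ger0_norm; last by rewrite ltW // !divr_gt0.
  by rewrite divfK // ltr_pdivrMr // ltr_pMr //; lra.
exists ((2 / r) ^+ 3); first by rewrite exprn_gt0 // divr_gt0.
move=> a b c; have [/nrm0_eq0 ->|a0] := eqVneq (nrm a) 0.
  by rewrite f0a !nrm0 !(mulr0,mul0r).
have [/nrm0_eq0 ->|b0] := eqVneq (nrm b) 0.
  by rewrite f0b !nrm0 !(mulr0,mul0r).
have [/nrm0_eq0 ->|c0] := eqVneq (nrm c) 0.
  by rewrite f0c !nrm0 !(mulr0,mul0r).
have := ltW (hr _ _ _ (unit_sc _ _ a0) (unit_sc _ _ b0) (unit_sc _ _ c0)).
rewrite fa fb fc !nrmZR !ger0_norm ?s0 //.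
set t := nrm (f a b c) => h.
have P : 0 < (2 / r * nrm a) * (2 / r * nrm b) * (2 / r * nrm c).
  by rewrite !mulr_gt0 ?invr_gt0 // lt_def nrm_ge0 andbT.
have E : (2 / r * nrm a) * (2 / r * nrm b) * (2 / r * nrm c) *
    (r / 2 / nrm a * (r / 2 / nrm b * (r / 2 / nrm c * t))) = t.
  by field; rewrite a0 b0 c0 gt_eqF.
have := ler_wpM2l (ltW P) h; rewrite E mulr1 => /le_trans; apply.
by rewrite le_eqVlt; apply/orP; left; apply/eqP; ring.
Qed.

Lemma additive_bounded_continuous (V W : normedModType R[i]) (f : V -> W) (K : R) :
  (forall x y, f (x - y) = f x - f y) -> (forall x, nrm (f x) <= K * nrm x) ->
  continuous f.
Proof.
move=> fB hK x; apply/cvgrPdist_lt => e e0.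
have [r0 er] : 0 < complex.Re e /\ e = (complex.Re e)%:C.
  by split; [move: e0; rewrite ltcE => /andP[] | exact/ge0_complexE/ltW].
set r := complex.Re e in r0 er; pose d := r / (`|K| + 1).
have K1 : 0 < `|K| + 1 by have := normr_ge0 K; lra.
have d0 : 0 < d by rewrite divr_gt0.
apply/nbhs_ballP; exists d%:C => /=; first by rewrite (ltcR 0).
move=> y; rewrite -ball_normE /ball_ /= nrmE ltcR ltr_pdivlMr // => xy.
rewrite -fB nrmE er ltcR; apply: le_lt_trans (hK _) _; apply: le_lt_trans xy.
by have := nrm_ge0 (x - y); have := ler_norm K; nra.
Qed.

End Bounded.

(** * Identities of Jordan triples *)

(** Scalars are left out so that the identities below also apply to the split null extension, which
    is not a [jordan_triple]: [m2] is conjugate linear in its outer variables too. *)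
Record add_triple (V : zmodType) (tp : V -> V -> V -> V) : Prop := {
  atDl : forall a a' b c, tp (a + a') b c = tp a b c + tp a' b c;
  atDm : forall a b b' c, tp a (b + b') c = tp a b c + tp a b' c;
  atDr : forall a b c c', tp a b (c + c') = tp a b c + tp a b c';
  at_sym : forall a b c, tp a b c = tp c b a;
  at_id : forall a b x y z, tp a b (tp x y z) - tp x y (tp a b z) =
    tp (tp a b x) y z - tp x (tp b a y) z }.

Section JordanIdentities.
Variables (K : numFieldType) (V : lmodType K) (tp : V -> V -> V -> V).
Hypothesis htp : add_triple tp.
Notation "{ a , b , c }" := (tp a b c).

Lemma mulrSn_eq0 (x : V) n : x *+ n.+1 = 0 -> x = 0.
Proof. by rewrite -scaler_nat => /eqP; rewrite scaler_eq0 pnatr_eq0 => /eqP. Qed.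

Lemma at_main a b x y z : {a, b, {x, y, z}} = {{a, b, x}, y, z} - {x, {b, a, y}, z} + {x, y, {a, b, z}}.
Proof. by rewrite -(at_id htp) subrK. Qed.

(* Skew-symmetry of the commutator of two box operators. *)
Lemma at_skew a b x y z :
  {{a, b, x}, y, z} + {{x, y, a}, b, z} = {x, {b, a, y}, z} + {a, {y, x, b}, z}.
Proof.
have h1 := at_id htp a b x y z; have h2 := at_id htp x y a b z.
apply/eqP; rewrite -subr_eq0 opprD addrACA -h1 -h2.
by rewrite addrA subrK subrr.
Qed.

Lemma at_skewQ a b y z :
  {{a, b, a}, y, z} + {{a, y, a}, b, z} = {a, {b, a, y}, z} *+ 2.
Proof. by rewrite at_skew mulr2n (at_sym htp y a b). Qed.

Lemma at_QL x y z : {x, y, {x, z, x}} = {x, {y, x, z}, x} /\ {{x, y, x}, z, x} = {x, {y, x, z}, x}.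
Proof.
have h1 := at_main x y x z x; have h2 := at_skewQ x y z x.
rewrite (at_sym htp x z {x, y, x}) in h1.
rewrite -(at_sym htp x y {x, z, x}) in h2.
move: h1 h2; set A := (tp x y _); set B := (tp (tp x y x) _ _); set C := (tp x (tp y x z) x).
move=> h1 h2.
(* The main identity reads A = 2B - C and [at_skewQ] reads B + A = 2C; together they give 3B =
   3C. *)
have BC : B = C.
  apply/subr0_eq/(@mulrSn_eq0 _ 2).
  have : B + A = C *+ 2 by [].
  rewrite h1 => /eqP; rewrite -subr_eq0 => /eqP <-.
  rewrite mulrnBl !mulrS mulr0n addr0 !opprD !addrA; congr (_ - _ - _).
  by rewrite -[RHS]addrA addrAC -!addrA; congr (_ + _); rewrite addrC -addrA; congr (_ + _); rewrite addrC.
by split=> //; rewrite h1 BC subrr add0r.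
Qed.

(** The fundamental formula Q(Q(x)y) = Q(x)Q(y)Q(x). [h1] collects the left side under a single
    Q(x), and [h3] recognises its argument as Q(y)Q(x)z. *)
Lemma at_fundamental x y z :
  {{x, y, x}, z, {x, y, x}} = {x, {y, {x, z, x}, y}, x}.
Proof.
have h1 : {{x, y, x}, z, {x, y, x}} =
    {x, {y, x, {y, x, z}}, x} *+ 2 - {x, {{y, x, y}, x, z}, x}.
  rewrite at_main (at_sym htp x y {_, z, x}) (at_QL x y z).2 (at_QL x _ y).2.
  rewrite (at_sym htp {y, x, z}) addrAC mulr2n; congr (_ - {x, _, x}).
  rewrite (at_sym htp z) .
  have := at_skewQ y x x z; rewrite -mulr2n => /eqP.
  rewrite -subr_eq0 -mulrnBl => /eqP/(@mulrSn_eq0 _ 1)/subr0_eq ->.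
  by [].
have h2 : {z, x, {y, x, y}} = {{z, x, y}, x, y} *+ 2 - {y, {x, z, x}, y}.
  by rewrite at_main (at_sym htp y x {z, x, y}) mulr2n addrAC.
have h3 : {y, {x, z, x}, y} = {y, x, {y, x, z}} *+ 2 - {{y, x, y}, x, z}.
  rewrite (at_sym htp {y, x, y}) h2 opprB addrC.
  by rewrite (at_sym htp z) (at_sym htp {y, x, z}) subrK.
rewrite h1 h3.
have B a b : {x, a - b, x} = {x, a, x} - {x, b, x}.
  by apply/eqP; rewrite eq_sym subr_eq -(atDm htp) subrK.
by rewrite B mulr2n (atDm htp) -mulr2n.
Qed.

(* The odd powers: tpow a k stands for a^(2k+1), so that pev (tpow tp a) p below
   is the odd polynomial t * p(t^2) evaluated at a. *)
Definition tpow (a : V) k := iter k (tp a a) a.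

Lemma tpowS a k : tpow a k.+1 = {a, a, tpow a k}.
Proof. by []. Qed.

(* For fixed k the operators L(a_m, a_(k+1-m)) form an arithmetic progression in m,
   whose common difference at_skewQ forces to vanish. *)
Lemma tpow_L a k i j i' j' z : (i + j)%N = k -> (i' + j')%N = k ->
  {tpow a i, tpow a j, z} = {tpow a i', tpow a j', z}.
Proof.
elim: k i j i' j' z => [|k IH] i j i' j' z.
  by move=> /eqP; rewrite addn_eq0 => /andP[/eqP -> /eqP ->] /eqP; rewrite addn_eq0 => /andP[/eqP -> /eqP ->].
pose D := {a, a, {a, tpow a k, z}} - {a, tpow a k, {a, a, z}}.
have step m : (m <= k)%N ->
    {tpow a m.+1, tpow a (k - m), z} = {tpow a m, tpow a (k - m).+1, z} + D.
  move=> mk; apply/eqP; rewrite addrC -subr_eq -(at_id htp) /D; apply/eqP.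
  have mk' : (m + (k - m))%N = k by rewrite subnKC.
  by rewrite (IH _ _ 0%N k z mk' erefl) (IH _ _ 0%N k {a, a, z} mk' erefl).
have ap m : (m <= k.+1)%N ->
    {tpow a m, tpow a (k.+1 - m), z} = {a, tpow a k.+1, z} + D *+ m.
  elim: m => [|m IHm] mk; first by rewrite subn0 mulr0n addr0.
  by rewrite subSS (step _ mk) -(subSn mk) (IHm (ltnW mk)) -addrA -mulrSr.
have D0 : D = 0.
  apply: (@mulrSn_eq0 _ k.+1).
  have e1 : {a, tpow a k, a} = tpow a k.+1.
    by rewrite (IH 0%N k k 0%N) ?addn0 // (at_sym htp).
  have := at_skewQ a a (tpow a k) z; rewrite e1 -[{a, a, a}]/(tpow a 1) -tpowS.
  have := ap 1%N isT; rewrite subSS subn0 => ->.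
  have := ap k.+1 (leqnn _); rewrite subnn => ->.
  rewrite addrACA -mulr2n -mulrnDr -[RHS]addr0 => /addrI.
  by rewrite add1n.
move=> h h'.
have red m n : (m + n)%N = k.+1 -> {tpow a m, tpow a n, z} = {a, tpow a k.+1, z}.
  move=> mn; have <- : (k.+1 - m = n)%N by rewrite -mn addKn.
  by rewrite ap ?D0 ?mul0rn ?addr0 // -mn; exact: leq_addr.
by rewrite (red _ _ h) (red _ _ h').
Qed.

Lemma tpow_assoc a i j l : {tpow a i, tpow a j, tpow a l} = tpow a (i + j + l).+1.
Proof.
rewrite (@tpow_L a (i + j) i j (i + j) 0) ?addn0 // (at_sym htp).
rewrite (@tpow_L a l l 0 0 l) ?addn0 // (at_sym htp).
by rewrite (@tpow_L a (i + j + l) _ _ (i + j + l) 0) ?addn0 // (at_sym htp).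
Qed.

End JordanIdentities.

(** * Odd polynomials of one element *)

Section PolynomialEvaluation.
Variables (R : realType) (E : lmodType R[i]).

(** The sequence [v] is arbitrary because [pev] also evaluates box operators ([pev_box]) and
    transports polynomial identities to vectors ([cubic_combination]). *)
Definition pev (v : nat -> E) (p : {poly R[i]}) := \sum_(k < size p) p`_k *: v k.

Lemma pevE v (p : {poly R[i]}) n : (size p <= n)%N -> pev v p = \sum_(k < n) p`_k *: v k.
Proof.
move=> pn; rewrite /pev (big_ord_widen n (fun k => p`_k *: v k) pn) big_mkcond.
apply: eq_bigr => k _; case: ltnP => // h.
by rewrite nth_default // scale0r.
Qed.

Lemma pev_linear v : linear (pev v).
Proof.
move=> c p q; pose n := maxn (size (c *: p + q)) (maxn (size p) (size q)).
rewrite !(@pevE _ _ n) ?leq_max ?leqnn ?orbT //.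
rewrite scaler_sumr -big_split; apply: eq_bigr => k _.
by rewrite coefD coefZ scalerDl scalerA.
Qed.

HB.instance Definition _ v := GRing.isLinear.Build R[i] {poly R[i]} E _ (pev v) (pev_linear v).

Lemma pevD v p q : pev v (p + q) = pev v p + pev v q.
Proof. exact: linearD. Qed.

Lemma pevB v p q : pev v (p - q) = pev v p - pev v q.
Proof. exact: linearB. Qed.

Lemma pevZ v c p : pev v (c *: p) = c *: pev v p.
Proof. exact: linearZ. Qed.

Lemma pevMn v p n : pev v (p *+ n) = pev v p *+ n.
Proof. exact: linearMn. Qed.

Lemma pevXn v k : pev v 'X^k = v k.
Proof.
rewrite /pev size_polyXn big_ord_recr /= coefXn eqxx scale1r big1 ?add0r // => i _.
by rewrite coefXn ltn_eqF // scale0r.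
Qed.

End PolynomialEvaluation.

Definition conjp (R : realType) : {poly R[i]} -> {poly R[i]} := map_poly (@Num.conj R[i]).
Definition rpoly (R : realType) : {poly R} -> {poly R[i]} := map_poly (real_complex R).

HB.instance Definition _ (R : realType) :=
  GRing.RMorphism.copy (@conjp R) (map_poly (@Num.conj R[i])).
HB.instance Definition _ (R : realType) :=
  GRing.RMorphism.copy (@rpoly R) (map_poly (real_complex R)).

Section ConjReal.
Variable R : realType.
Implicit Types (p q : {poly R[i]}) (x y : {poly R}).

Lemma conj_realC (r : R) : Num.conj (r%:C) = r%:C :> R[i].
Proof. by apply: conj_Creal; rewrite complex_real. Qed.

Lemma conjpK : involutive (@conjp R).
Proof. by move=> p; apply/polyP => i; rewrite !coef_map /= conjCK. Qed.

Lemma conjpX : conjp 'X = 'X :> {poly R[i]}.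
Proof. by rewrite /conjp map_polyX. Qed.

Lemma conjpZ (c : R[i]) p : conjp (c *: p) = Num.conj c *: conjp p.
Proof. by rewrite /conjp linearZ. Qed.

Lemma conjp_rpoly x : conjp (rpoly x) = rpoly x.
Proof. by apply/polyP => i; rewrite !coef_map /= conj_realC. Qed.

Lemma rpolyX : rpoly 'X = 'X :> {poly R[i]}.
Proof. by rewrite /rpoly map_polyX. Qed.

Lemma rpolyB x y : rpoly (x - y) = rpoly x - rpoly y.
Proof. exact: rmorphB. Qed.

Lemma rpolyM x y : rpoly (x * y) = rpoly x * rpoly y.
Proof. exact: rmorphM. Qed.

Lemma rpolyZ (c : R) x : rpoly (c *: x) = c%:C *: rpoly x.
Proof. by rewrite /rpoly linearZ. Qed.

Lemma horner_rpoly x (r : R) : (rpoly x).[r%:C] = (x.[r])%:C.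
Proof. by rewrite /rpoly horner_map. Qed.

End ConjReal.

Lemma pev_rpolyB (R : realType) (E : lmodType R[i]) (v : nat -> E) (x y : {poly R}) :
  pev v (rpoly x) - pev v (rpoly y) = pev v (rpoly (x - y)).
Proof. by rewrite rpolyB pevB. Qed.

Section TripleLinearity.
Variables (R : realType) (E : lmodType R[i]) (tp : E -> E -> E -> E).
Hypothesis jt : jordan_triple tp.

Lemma tpDl a a' b c : tp (a + a') b c = tp a b c + tp a' b c.
Proof. by have := jt_linear_l jt b c 1 a a'; rewrite !scale1r. Qed.
Lemma tpDm a b b' c : tp a (b + b') c = tp a b c + tp a b' c.
Proof. by have := jt_conj_m jt a c 1 b b'; rewrite /= conjC1 !scale1r. Qed.
Lemma tpDr a b c c' : tp a b (c + c') = tp a b c + tp a b c'.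
Proof. by have := jt_linear_r jt a b 1 c c'; rewrite !scale1r. Qed.
Lemma tp_add_triple : add_triple tp.
Proof. by split; [exact: tpDl | exact: tpDm | exact: tpDr | exact: jt_sym | exact: jt_identity]. Qed.
Lemma tp0l b c : tp 0 b c = 0.
Proof. by apply: (addrI (tp 0 b c)); rewrite -tpDl !addr0. Qed.
Lemma tp0m a c : tp a 0 c = 0.
Proof. by apply: (addrI (tp a 0 c)); rewrite -tpDm !addr0. Qed.
Lemma tp0r a b : tp a b 0 = 0.
Proof. by apply: (addrI (tp a b 0)); rewrite -tpDr !addr0. Qed.
Lemma tpZl k a b c : tp (k *: a) b c = k *: tp a b c.
Proof. by have := jt_linear_l jt b c k a 0; rewrite tp0l !addr0. Qed.
Lemma tpZm k a b c : tp a (k *: b) c = Num.conj k *: tp a b c.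
Proof. by have := jt_conj_m jt a c k b 0; rewrite /= tp0m !addr0. Qed.
Lemma tpZr k a b c : tp a b (k *: c) = k *: tp a b c.
Proof. by have := jt_linear_r jt a b k c 0; rewrite tp0r !addr0. Qed.
Lemma tpNl a b c : tp (- a) b c = - tp a b c.
Proof. by rewrite -scaleN1r tpZl scaleN1r. Qed.
Lemma tpNm a b c : tp a (- b) c = - tp a b c.
Proof. by rewrite -scaleN1r tpZm rmorphN rmorph1 scaleN1r. Qed.
Lemma tpNr a b c : tp a b (- c) = - tp a b c.
Proof. by rewrite -scaleN1r tpZr scaleN1r. Qed.

Lemma tp_suml I (r : seq I) F b c : tp (\sum_(i <- r) F i) b c = \sum_(i <- r) tp (F i) b c.
Proof. by apply: (big_morph (fun x => tp x b c)) => [x y|]; rewrite ?tpDl ?tp0l. Qed.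
Lemma tp_summ I (r : seq I) F a c : tp a (\sum_(i <- r) F i) c = \sum_(i <- r) tp a (F i) c.
Proof. by apply: (big_morph (fun x => tp a x c)) => [x y|]; rewrite ?tpDm ?tp0m. Qed.
Lemma tp_sumr I (r : seq I) F a b : tp a b (\sum_(i <- r) F i) = \sum_(i <- r) tp a b (F i).
Proof. by apply: (big_morph (fun x => tp a b x)) => [x y|]; rewrite ?tpDr ?tp0r. Qed.

(** With X standing for t^2 this is (t p)(t conj q)(t r) = t (p conj q r t^2), whence the additional
    factor ['X]. *)
Lemma pev_triple a p q r :
  tp (pev (tpow tp a) p) (pev (tpow tp a) q) (pev (tpow tp a) r) =
  pev (tpow tp a) (p * conjp q * r * 'X).
Proof.
have pdef (s : {poly R[i]}) : s = \sum_(k < size s) s`_k *: 'X^k by rewrite -poly_def coefK.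
rewrite [in RHS](pdef p) [in RHS](pdef q) [in RHS](pdef r).
rewrite [in RHS]/conjp (rmorph_sum (map_poly (@Num.conj R[i]))).
rewrite !mulr_suml linear_sum /= [X in tp X _ _]/pev tp_suml; apply: eq_bigr => i _.
rewrite mulr_sumr !mulr_suml linear_sum /= [X in tp _ _ X]/pev tp_sumr; apply: eq_bigr => l _.
rewrite mulr_sumr !mulr_suml linear_sum /= [X in tp _ X _]/pev tp_summ; apply: eq_bigr => j _.
rewrite linearZ /= map_polyXn -!scalerAl -!scalerAr -!scalerAl.
rewrite !linearZ /= -!exprD -exprSr pevXn tpZl tpZm tpZr (tpow_assoc tp_add_triple).
by rewrite !scalerA; congr (_ *: _); ring.
Qed.

End TripleLinearity.

(** Extracting 3^n-th roots removes [K]. If x = y (1 + d) with d > 0, Bernoulli's inequality makes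
    (1 + d)^(3^n) exceed [K]. *)
Lemma le_of_pow3_le (R : realType) (K x y : R) : 0 <= x -> 0 <= y ->
  (forall n, x ^+ (3 ^ n) <= K * y ^+ (3 ^ n)) -> x <= y.
Proof.
move=> x0 y0 h; rewrite leNgt; apply/negP => yx.
have [y00|yn0] := eqVneq y 0.
  by have := h 0%N; rewrite y00 mulr0; lra.
have yp : 0 < y by rewrite lt_def yn0.
pose d := x / y - 1.
have d0 : 0 < d by rewrite subr_gt0 ltr_pdivlMr // mul1r.
have xE : x = y * (1 + d) by rewrite /d addrC subrK mulrC divfK.
have bern m : 1 + m%:R * d <= (1 + d) ^+ m.
  elim: m => [|m IH]; first by rewrite mul0r addr0 expr0.
  by rewrite exprS -natr1; have := ler0n R m; nra.
have K_bound n : n%:R * d <= K.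
  have := h n; rewrite xE exprMn mulrC ler_pM2r ?exprn_gt0 // => hn.
  have n3 : (n <= 3 ^ n)%N by apply: ltnW; exact: ltn_expl.
  have : n%:R <= (3 ^ n)%:R :> R by rewrite ler_nat.
  by have := bern (3 ^ n)%N; nra.
have [m hm] : exists m : nat, K / d < m%:R.
  exists (Num.bound `|K / d|); apply: le_lt_trans (ler_norm _) _.
  exact: (archi_boundP (normr_ge0 _)).
by have := K_bound m; rewrite -ler_pdivlMr // leNgt hm.
Qed.

(** * C*-estimates for odd polynomials of one element *)

Section TripleNorm.
Variables (R : realType) (E : normedModType R[i]) (tp : E -> E -> E -> E).
Hypothesis jt : jordan_triple tp.
Variable K : R.
Hypothesis tp_bound : forall a b c, nrm (tp a b c) <= K * nrm a * nrm b * nrm c.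
Hypothesis tp_cube : forall a, nrm (tp a a a) = nrm a ^+ 3.
Variable a : E.

Local Notation ev := (pev (tpow tp a)).
Local Notation N p := (nrm (pev (tpow tp a) p)).
Implicit Types (p q r : {poly R[i]}) (x y : {poly R}).

Lemma pev_cube_nrm p : N (p * conjp p * p * 'X) = N p ^+ 3.
Proof. by rewrite -(pev_triple jt) tp_cube. Qed.

(* The cube map is multiplicative up to conjugation, so iterating it
   absorbs the continuity constant of the triple product. *)
Lemma pev_triple_nrm p q r : N (p * conjp q * r * 'X) <= N p * N q * N r.
Proof.
suff h n : forall p q r,
    N (p * conjp q * r * 'X) ^+ (3 ^ n) <= K * (N p * N q * N r) ^+ (3 ^ n).
  by apply: (le_of_pow3_le _ _ (fun n => h n p q r)); rewrite ?mulr_ge0 ?nrm_ge0.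
elim: n => [|n IH] p0 q0 r0.
  by rewrite !expr1 -(pev_triple jt) !mulrA.
rewrite expnS !exprM -pev_cube_nrm.
set P := p0 * _ * _ * _.
have -> : P * conjp P * P * 'X = (p0 * conjp p0 * p0 * 'X) *
    conjp (q0 * conjp q0 * q0 * 'X) * (r0 * conjp r0 * r0 * 'X) * 'X.
  by rewrite /P !rmorphM /= !conjpK conjpX; ring.
apply: le_trans (IH _ _ _) _.
by rewrite !pev_cube_nrm -!exprMn.
Qed.

(** Applied to q, conj q, conj q, [pev_triple_nrm] bounds N(q)^3 by N(q) N(conj q)^2. *)
Lemma pev_conj_le q : N q <= N (conjp q).
Proof.
have [->|q0] := eqVneq (N q) 0; first exact: nrm_ge0.
have qp : 0 < N q by rewrite lt_def q0 nrm_ge0.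
have := pev_triple_nrm q (conjp q) (conjp q).
rewrite conjpK -(mulrA q) (mulrC q (conjp q)) !mulrA pev_cube_nrm.
rewrite exprS -mulrA ler_pM2l // -expr2 => h.
by rewrite -(ler_pXn2r (n:=2)) ?nnegrE ?nrm_ge0.
Qed.

Lemma pev_conj q : N (conjp q) = N q.
Proof. by apply/eqP; rewrite eq_le pev_conj_le andbT -{2}[q]conjpK pev_conj_le. Qed.

Lemma pev1 : ev 1 = a.
Proof. by have := pevXn (tpow tp a) 0; rewrite expr0. Qed.

Lemma pevX p : ev ('X * p) = tp a a (ev p).
Proof. by rewrite -{2 3}pev1 (pev_triple jt) rmorph1 !mul1r mulrC. Qed.

(* Upper and lower bounds for the multiplication by q on the subtriple generated by a. *)
Definition opb q (c : R) := 0 <= c /\ forall p, N (q * p) <= c * N p.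
Definition lbd q (g : R) := 0 < g /\ forall p, g * N p <= N (q * p).

Lemma opbM p q c d : opb p c -> opb q d -> opb (p * q) (c * d).
Proof.
move=> [c0 hc] [d0 hd]; split; first exact: mulr_ge0.
by move=> s; rewrite -mulrA; apply: le_trans (hc _) _; rewrite -mulrA ler_wpM2l.
Qed.

Lemma opbD p q c d : opb p c -> opb q d -> opb (p + q) (c + d).
Proof.
move=> [c0 hc] [d0 hd]; split; first exact: addr_ge0.
move=> s; rewrite mulrDl pevD; apply: le_trans (nrmD _ _) _.
by rewrite mulrDl lerD.
Qed.

Lemma opbZ (k : R) q c : opb q c -> opb (k%:C *: q) (`|k| * c).
Proof.
move=> [c0 hc]; split; first by rewrite mulr_ge0.
by move=> s; rewrite -scalerAl linearZ /= nrmZR -mulrA ler_wpM2l.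
Qed.

Lemma opb_le q c d : opb q c -> c <= d -> opb q d.
Proof.
move=> [c0 hc] cd; split; first exact: le_trans cd.
by move=> p; apply: le_trans (hc p) _; rewrite ler_wpM2r // nrm_ge0.
Qed.

Lemma opb1 : opb 1 1.
Proof. by split=> // p; rewrite !mul1r. Qed.

Lemma opbX : opb 'X (nrm a ^+ 2).
Proof.
split=> [|p]; first by rewrite sqr_ge0.
by have := pev_triple_nrm 1 1 p; rewrite rmorph1 !mul1r mulrC pev1 expr2.
Qed.

Lemma opb_exists q : exists c, opb q c.
Proof.
elim/poly_ind: q => [|q c [d hd]].
  by exists 0; split=> // p; rewrite !mul0r linear0 nrm0.
exists (d * nrm a ^+ 2 + complex.Re `|c|); apply: opbD; first exact: opbM opbX.
split; first by have := normr_ge0 c; rewrite lecE => /andP[].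
by move=> p; rewrite mul_polyC linearZ /= nrmZ.
Qed.

Lemma opb_conj q c : opb q c -> opb (conjp q) c.
Proof.
move=> [c0 hc]; split=> // p.
by rewrite -pev_conj -[N p]pev_conj rmorphM /= conjpK.
Qed.

(* The polynomials acting on the subtriple generated by a satisfy the C*-inequality. *)
Lemma opb_cstar q c : 0 <= c -> opb (q * conjp q) (c ^+ 2) -> opb q c.
Proof.
move=> c0 [_ hc]; split=> // p.
have [->|n0] := eqVneq (N (q * p)) 0; first by rewrite mulr_ge0 // nrm_ge0.
have np : 0 < N (q * p) by rewrite lt_def n0 nrm_ge0.
rewrite -(ler_pXn2r (n:=2)) ?nnegrE ?mulr_ge0 ?nrm_ge0 //.
rewrite -(ler_pM2l np) -exprS -pev_cube_nrm rmorphM /=.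
have -> : q * p * (conjp q * conjp p) * (q * p) * 'X =
   q * conjp q * ((q * p) * conjp p * p * 'X) by ring.
apply: le_trans (hc _) _.
have := pev_triple_nrm (q * p) p p; have := sqr_ge0 c; rewrite exprMn; nra.
Qed.

Lemma opb_sqr x c : 0 <= c -> opb (rpoly (x ^+ 2)) (c ^+ 2) -> opb (rpoly x) c.
Proof. by move=> c0; rewrite expr2 rmorphM /= -{2}[rpoly x]conjp_rpoly; exact: opb_cstar. Qed.

(** Here x is the real part of z = x + i y, and [opb_cstar] applies to z because z conj z = x^2 +
    y^2. *)
Lemma opb_sum_sqr x y c : 0 <= c -> opb (rpoly (x ^+ 2 + y ^+ 2)) (c ^+ 2) -> opb (rpoly x) c.
Proof.
move=> c0 h; pose z := rpoly x + 'i%R *: rpoly y.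
have zbE : conjp z = rpoly x - 'i%R *: rpoly y.
  by rewrite /z rmorphD /= conjpZ !conjp_rpoly conjCi scaleNr.
have zE : z * conjp z = rpoly (x ^+ 2 + y ^+ 2).
  have conj_id (X Y j : {poly R[i]}) : j ^+ 2 = -1 -> (X + j * Y) * (X - j * Y) = X ^+ 2 + Y ^+ 2.
    by move=> jj; rewrite mulrC -subr_sqr exprMn jj mulN1r opprK.
  rewrite zbE /z rmorphD !rmorphXn /= -!mul_polyC; apply: conj_id.
  by rewrite -rmorphXn /= sqrCi rmorphN rmorph1.
have hz : opb z c by apply: opb_cstar => //; rewrite zE.
have xE : rpoly x = (2^-1)%:C *: (z + conjp z).
  rewrite zbE /z addrACA subrr addr0 -mulr2n -[rpoly x *+ 2]scaler_nat scalerA.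
  rewrite -(rmorph_nat (real_complex R)) -rmorphM /=.
  by rewrite mulVf ?scale1r // pnatr_eq0.
rewrite xE; have := opbZ (2^-1) (opbD hz (opb_conj hz)).
by rewrite ger0_norm ?invr_ge0 // (_ : 2^-1 * (c + c) = c) //; field.
Qed.

(** Lower bounds play the part of invertibility; being multiplicative, they can be checked on linear
    factors. *)
Lemma lbdM p q c d : lbd p c -> lbd q d -> lbd (p * q) (c * d).
Proof.
move=> [c0 hc] [d0 hd]; split; first exact: mulr_gt0.
move=> s; rewrite -mulrA -mulrA; apply: le_trans (hc _).
by rewrite ler_pM2l.
Qed.

Lemma lbdC (c : R[i]) : c != 0 -> exists g, lbd c%:P g.
Proof.
move=> c0; exists (complex.Re `|c|); split.
  by have : 0 < `|c| by [rewrite normr_gt0]; rewrite ltcE => /andP[].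
by move=> p; rewrite mul_polyC linearZ /= nrmZ.
Qed.

Lemma lbd_prod (rs : seq R[i]) : (forall z, z \in rs -> exists g, lbd ('X - z%:P) g) ->
  exists g, lbd (\prod_(z <- rs) ('X - z%:P)) g.
Proof.
elim: rs => [|z rs IH] h.
  by rewrite big_nil; exists 1; split => // p; rewrite !mul1r.
have [|g hg] := IH; first by move=> w wr; apply: h; rewrite inE wr orbT.
have [g' hg'] := h z (mem_head _ _).
by exists (g' * g); rewrite big_cons; exact: lbdM.
Qed.

Lemma opb_double y B c : 0 <= c ->
  opb (rpoly ((1 + y ^+ 2) * B)) c -> opb (rpoly (y * B *+ 2)) c.
Proof.
move=> c0 h; apply: (@opb_sum_sqr _ ((1 - y ^+ 2) * B)) => //.
have -> : (y * B *+ 2) ^+ 2 + ((1 - y ^+ 2) * B) ^+ 2 = ((1 + y ^+ 2) * B) ^+ 2.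
  by rewrite -mulr_natl; ring.
by rewrite expr2 rmorphM /= expr2; exact: opbM.
Qed.

(** Each induction step peels off one factor by [opb_double] and passes from (y, B) to (y^2, 2yB);
    the exponents 1 + 2 + ... + 2^(k-1) add up to 2^k - 1. *)
Lemma opb_geometric k : forall y B c, 0 <= c ->
  opb (rpoly (\prod_(i < k) (1 + y ^+ 2 ^+ (2 ^ i)) * B)) c ->
  opb (rpoly (y ^+ (2 ^ k).-1 * B *+ (2 ^ k))) c.
Proof.
elim: k => [|k IH] y B c c0; first by rewrite big_ord0 /= mulr1n.
rewrite big_ord_recl /= expn0 expr1 -mulrA => /(opb_double c0).
have -> : y * (\prod_(i < k) (1 + y ^+ 2 ^+ (2 ^ bump 0 i)) * B) *+ 2 =
    \prod_(i < k) (1 + (y ^+ 2) ^+ 2 ^+ (2 ^ i)) * (y * B *+ 2).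
  rewrite mulrnAr mulrCA; congr (_ * _ *+ 2); apply: eq_bigr => i _.
  by rewrite /bump add1n expnS -!exprM mulnA.
move=> /(IH _ _ _ c0); congr (opb (rpoly _) _).
rewrite mulrnAr -mulrnA mulrA -expnS; congr (_ * _ *+ _).
by rewrite -exprM -exprSr expnS; congr (_ ^+ _); have := expn_gt0 2 k; lia.
Qed.

Lemma prod_geometric y k :
  (1 - y) * \prod_(i < k) (1 + y ^+ (2 ^ i)) = 1 - y ^+ (2 ^ k).
Proof.
elim: k => [|k IH]; first by rewrite big_ord0 mulr1 expn0 expr1.
by rewrite big_ord_recr /= mulrA IH expnS mulnC exprM; ring.
Qed.

Lemma opb_exp x k : opb (rpoly x) 1 -> opb (rpoly (x ^+ k)) 1.
Proof.
move=> h; elim: k => [|k IH]; first by rewrite expr0 rmorph1; exact: opb1.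
by rewrite exprS rmorphM /= -[1](mulr1 1); exact: opbM.
Qed.

Lemma opb_root x k : (exists2 t, t < 1 & opb (rpoly (x ^+ (2 ^ k))) t) ->
  exists2 t, t < 1 & opb (rpoly x) t.
Proof.
elim: k => [|k IH]; first by rewrite expn0 expr1.
move=> [t t1 ht]; apply: IH; exists (Num.sqrt t).
  by rewrite -sqrtr1 ltr_sqrt.
apply: opb_sqr; rewrite ?sqrtr_ge0 // -exprM mulnC -expnS sqr_sqrtr //.
by case: ht.
Qed.

(* Writing G for the product of the 1 + x^(2^(i+1)), i < k, the identity
   (1 + y^2)^2 = (2 y)^2 + (1 - y^2)^2 shows that 2^k x^(2^k - 1) is dominated by G,
   and G is bounded uniformly in k because (1 - x^2) G = 1 - x^(2^(k+1)). *)
Lemma opb_strict x g : opb (rpoly x) 1 -> lbd (rpoly (1 - x ^+ 2)) g ->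
  exists2 t, t < 1 & opb (rpoly x) t.
Proof.
move=> x1 [g0 hg].
have [k hk] : exists k, 4 / g < 2 ^+ k.
  exists (Num.bound `|4 / g|); apply: le_lt_trans (ler_norm _) _.
  apply: lt_le_trans (archi_boundP (normr_ge0 _)) _.
  by rewrite -natrX ler_nat ltnW // ltn_expl.
apply: (@opb_root _ k); exists (1 / 2); first lra.
have G : opb (rpoly (\prod_(i < k) (1 + x ^+ 2 ^+ (2 ^ i)) * 1)) (2 / g).
  split=> [|p]; first by rewrite divr_ge0 // ltW.
  rewrite mulr1 mulrAC ler_pdivlMr // mulrC; apply: le_trans (hg _) _.
  rewrite mulrA -rpolyM prod_geometric -exprM rpolyB rmorph1.
  rewrite mulrBl mul1r pevB; apply: le_trans (nrmB _ _) _.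
  by have [_ /(_ p)] := opb_exp (2 * 2 ^ k) x1; lra.
have /opb_geometric/opbZ : opb (rpoly (\prod_(i < k) (1 + x ^+ 2 ^+ (2 ^ i)) * 1)) (2 / g) by [].
move=> /(_ (2 ^- k)); rewrite divr_ge0 ?ltW // => /(_ isT).
rewrite mulr1 -rpolyZ -[_ *+ (2 ^ k)]scaler_nat scalerA natrX mulVf ?expf_neq0 ?pnatr_eq0 // scale1r.
(* One more factor [x] completes the exponent to 2^k, as [opb_root] requires; the bound (2/g)/2^k is
   below 1/2 by the choice of [k]. *)
move=> /(opbM x1); rewrite -rmorphM /= -exprS prednK ?expn_gt0 //.
move=> /opb_le; apply.
rewrite mul1r ger0_norm ?invr_ge0 ?exprn_ge0 // mulrC ler_pdivrMr ?exprn_gt0 //.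
lra.
Qed.

Hypothesis a1 : nrm a <= 1.
Hypothesis tp_spectrum : forall z : R[i], ~~ (0 <= z) ->
  exists2 g : R, 0 < g & forall b, g * nrm b <= nrm (tp a a b - z *: b).

(** Off the nonnegative reals this is the spectral condition. A real z > 1 exceeds the bound ||a||^2
    <= 1 of multiplication by X. *)
Lemma lbd_root (z : R[i]) : (forall r : R, 0 <= r <= 1 -> z <> r%:C) ->
  exists g, lbd ('X - z%:P) g.
Proof.
move=> hz; have evE p : ev (('X - z%:P) * p) = tp a a (ev p) - z *: ev p.
  by rewrite mulrBl pevB pevX mul_polyC pevZ.
have [z0|] := boolP (0 <= z); last first.
  by move=> /tp_spectrum[g g0 hg]; exists g; split=> // p; rewrite evE.
have zE := ge0_complexE z0; set r := complex.Re z in zE.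
have r0 : 0 <= r by rewrite -ler0c -zE.
have r1 : 1 < r by rewrite ltNge; apply/negP => r1; apply: (hz r) => //; rewrite r0.
exists (r - 1); split=> [|p]; first lra.
rewrite evE -pevX; have [_ /(_ p)] := opbX.
have := nrm_triangle (ev ('X * p)) (z *: ev p) 0.
rewrite !subr0 (nrm_distC (z *: _)) zE nrmZR ger0_norm //.
have : nrm a ^+ 2 <= 1 by rewrite expr_le1 // nrm_ge0.
have := nrm_ge0 (ev p); nra.
Qed.

(* If the least bound c exceeded m, then 1 - (x/c)^2 would split into factors X - z with
   z outside [0,1], each bounded below, contradicting opb_strict. *)
Theorem opb_sup x (m : R) : 0 <= m ->
  (forall t : R, 0 <= t <= 1 -> `|x.[t]| <= m) -> opb (rpoly x) m.
Proof.
move=> m0 hm; pose S := [set c | opb (rpoly x) c].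
have S0 : S !=set0 by have [c hc] := opb_exists (rpoly x); exists c.
have lS : lbound S 0 by move=> c [].
have hS : has_inf S by split=> //; exists 0.
set c := inf S.
have c0 : 0 <= c by apply: lb_le_inf.
have Sc : opb (rpoly x) c.
  split=> // p; have [p0|p0] := eqVneq (N p) 0.
    by have [d [_ /(_ p)]] := S0; rewrite p0 !mulr0.
  have pp : 0 < N p by rewrite lt_def p0 nrm_ge0.
  rewrite -ler_pdivrMr //; apply: lb_le_inf => // d [_ /(_ p)].
  by rewrite ler_pdivrMr.
apply: (opb_le Sc); rewrite leNgt; apply/negP => mc.
have cp : 0 < c by exact: le_lt_trans mc.
pose y := c^-1 *: x.
have y1 : opb (rpoly y) 1.
  by rewrite /y rpolyZ; have := opbZ c^-1 Sc; rewrite ger0_norm ?invr_ge0 // mulVf // gt_eqF.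
have yt (t : R) : 0 <= t <= 1 -> (1 - y ^+ 2).[t] > 0.
  move=> /hm ht.
  have -> : (1 - y ^+ 2).[t] = 1 - (x.[t] / c) ^+ 2 by rewrite /y !hornerE; ring.
  rewrite subr_gt0.
  rewrite -(real_normK (num_real _)) expr_lt1 // normrM normfV (gtr0_norm cp).
  by rewrite ltr_pdivrMr // mul1r; exact: le_lt_trans mc.
have [rs rsE] := closed_field_poly_normal (rpoly (1 - y ^+ 2)).
have lc0 : lead_coef (rpoly (1 - y ^+ 2)) != 0.
  rewrite lead_coef_eq0; apply/eqP => e.
  have := yt 0; rewrite lexx ler01 => /(_ isT).
  have := horner_rpoly (1 - y ^+ 2) 0; rewrite e horner0 => /complexI <-.
  by rewrite ltxx.
have [g1 hg1] := lbdC lc0.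
have [z zrs|g2 hg2] := @lbd_prod rs.
  apply: lbd_root => r r01 zr; have := yt r r01.
  have : root (rpoly (1 - y ^+ 2)) z.
    by rewrite rsE rootZ // root_prod_XsubC.
  by rewrite zr /root horner_rpoly => /eqP/complexI ->; rewrite ltxx.
have hl : lbd (rpoly (1 - y ^+ 2)) (g1 * g2).
  by rewrite rsE -mul_polyC; exact: lbdM.
have [t t1 ht] := opb_strict y1 hl.
have : S (c * t).
  rewrite /S /= (_ : rpoly x = c%:C *: rpoly y); last first.
    by rewrite -rpolyZ /y scalerA mulfV ?scale1r // gt_eqF.
  by have := opbZ c ht; rewrite ger0_norm.
move=> /(ge_inf (ex_intro _ 0 lS)); rewrite -/c leNgt => /negP; apply.
by rewrite gtr_pMr.
Qed.

(** The operator bound returns to elements through N(x)^3 = N(X x^2 * x): at u = t^2 the polynomial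
    X x^2 equals (t x(t^2))^2, so [opb_sup] bounds it by m^2. *)
Lemma pev_sup x (m : R) : 0 <= m ->
  (forall t : R, 0 <= t <= 1 -> `|t * x.[t ^+ 2]| <= m) -> N (rpoly x) <= m.
Proof.
move=> m0 hm.
have : opb (rpoly ('X * x ^+ 2)) (m ^+ 2).
  apply: opb_sup => [|u /andP[u0 u1]]; first exact: sqr_ge0.
  have := hm (Num.sqrt u); rewrite sqrtr_ge0 -sqrtr1 ler_wsqrtr // sqr_sqrtr // => /(_ isT).
  have -> : ('X * x ^+ 2).[u] = (Num.sqrt u * x.[u]) ^+ 2.
    by rewrite exprMn sqr_sqrtr // !hornerE; ring.
  move=> h; rewrite ger0_norm ?sqr_ge0 // -(real_normK (num_real (_ * _))).
  by rewrite ler_pXn2r ?nnegrE.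
move=> [_ /(_ (rpoly x))]; have [->//|n0] := eqVneq (N (rpoly x)) 0.
have np : 0 < N (rpoly x) by rewrite lt_def n0 nrm_ge0.
have -> : rpoly ('X * x ^+ 2) * rpoly x = rpoly x * conjp (rpoly x) * rpoly x * 'X.
  by rewrite conjp_rpoly rmorphM rmorphXn /= rpolyX; ring.
rewrite pev_cube_nrm exprSr ler_pM2r // => h.
by rewrite -(ler_pXn2r (n:=2)) ?nnegrE ?nrm_ge0.
Qed.

End TripleNorm.

Lemma tends_tri (R : realType) (A B C D : normedModType R[i]) (f : A -> B -> C -> D) u v w x y z :
  continuous (fun p : A * B * C => f p.1.1 p.1.2 p.2) ->
  tends u x -> tends v y -> tends w z -> tends (fun n => f (u n) (v n) (w n)) (f x y z).
Proof.
move=> cf /tendsP ux /tendsP vy /tendsP wz; apply/tendsP.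
pose h n := ((u n, v n), w n).
have hc : h @ \oo --> ((x, y), z) by exact: (cvg_pair (cvg_pair ux vy) wz).
exact: (continuous_cvg _ (cf ((x, y), z)) hc).
Qed.

(** * Functional calculus *)

Section RealApproximation.
Variable R : realType.

(* With P_n(t) = t * p_n(t^2) this is the iteration P_(n+1) = P_n + (t - P_n^3) / 3,
   which increases to the cube root of t on [0,1]. *)
Fixpoint cbrt_poly n : {poly R} :=
  if n is m.+1 then cbrt_poly m + 3^-1 *: (1 - 'X * cbrt_poly m ^+ 3) else 0.

Lemma cbrt_polyS n (u : R) :
  (cbrt_poly n.+1).[u] = (cbrt_poly n).[u] + (1 - u * (cbrt_poly n).[u] ^+ 3) / 3.
Proof. by rewrite /= !hornerE; ring. Qed.

(** One step multiplies the error r - P by 1 - (r^2 + r P + P^2)/3 <= 1 - r^2/3, and the weight 1 +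
    n r^2/3 is chosen to absorb that factor. *)
Lemma cbrt_poly_err (r : R) n : 0 <= r <= 1 ->
  let P := r ^+ 3 * (cbrt_poly n).[(r ^+ 3) ^+ 2] in
  [/\ 0 <= P, P <= r & (r - P) * (1 + n%:R * (r ^+ 2 / 3)) <= r].
Proof.
move=> /andP[r0 r1]; elim: n => [|n] /=.
  by rewrite horner0 mulr0 subr0 mul0r addr0 mulr1.
set Q := (cbrt_poly n).[_]; set P := r ^+ 3 * Q => -[P0 Pr IH].
rewrite -[cbrt_poly n + _]/(cbrt_poly n.+1) cbrt_polyS -/Q.
have -> : r ^+ 3 * (Q + (1 - r ^+ 3 ^+ 2 * Q ^+ 3) / 3) = P + (r ^+ 3 - P ^+ 3) / 3.
  by rewrite /P; field.
set P' := P + _.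
have E1 : r - P' = (r - P) * (1 - (r ^+ 2 + r * P + P ^+ 2) / 3) by rewrite /P'; field.
have c1 : (r ^+ 2 + r * P + P ^+ 2) / 3 <= 1 by rewrite ler_pdivrMr // mul1r; nra.
have c2 : r ^+ 2 / 3 <= (r ^+ 2 + r * P + P ^+ 2) / 3 by rewrite ler_pM2r //; nra.
have c3 : 0 <= r ^+ 2 / 3 by rewrite divr_ge0 // sqr_ge0.
move: E1 c1 c2 c3 IH; set S := ((r ^+ 2 + r * P + P ^+ 2) / 3); set s := r ^+ 2 / 3.
move=> E1 c1 c2 c3 IH.
have PP : 0 <= r ^+ 3 - P ^+ 3.
  by rewrite subr_ge0 ler_pXn2r ?nnegrE.
split; first by rewrite addr_ge0 // divr_ge0.
  by rewrite -subr_ge0 E1 mulr_ge0 // subr_ge0.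
rewrite E1 -natr1; have n0 := ler0n R n.
apply: le_trans IH; rewrite -mulrA ler_wpM2l ?subr_ge0 //.
have : (1 - S) * (1 + (n%:R + 1) * s) <= (1 - s) * (1 + (n%:R + 1) * s).
  by rewrite ler_wpM2r ?lerD2l ?lerN2 // addr_ge0 // mulr_ge0 // addr_ge0.
by have : 0 <= (n%:R + 1) * (s * s) by [rewrite mulr_ge0 ?mulr_ge0 ?addr_ge0]; lra.
Qed.

Lemma cbrt_poly_unif (e : R) : 0 < e -> exists M, forall n, (M <= n)%N -> forall r, 0 <= r <= 1 ->
  `|r ^+ 3 * (cbrt_poly n).[(r ^+ 3) ^+ 2] - r| <= e.
Proof.
(* For r <= e the error is at most r. For r > e, n >= 3/e^3 gives n e^3/3 >= 1, so an error above e
   would force r > 1. *)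
move=> e0; pose b := 3 / e ^+ 3.
exists (Num.bound `|b|) => n hn r r01; have [r0 r1] := andP r01.
have [P0 Pr h] := cbrt_poly_err n r01; set P := r ^+ 3 * _ in P0 Pr h *.
rewrite distrC ger0_norm ?subr_ge0 //.
have [re|re] := leP r e; first by have := subr_ge0 P r; lra.
have nb : b <= n%:R.
  apply: le_trans (ler_norm _) _; apply: le_trans (ltW (archi_boundP (normr_ge0 _))) _.
  by rewrite ler_nat.
rewrite leNgt; apply/negP => eP.
have n0 := ler0n R n.
have : 3 <= n%:R * e ^+ 3 by rewrite -ler_pdivrMr ?exprn_gt0.
have : e * (1 + n%:R * (e ^+ 2 / 3)) < r.
  apply: lt_le_trans h.
  have : n%:R * (e ^+ 2 / 3) <= n%:R * (r ^+ 2 / 3).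
    by rewrite ler_wpM2l // ler_pM2r // ler_pXn2r ?nnegrE // ltW.
  have : 0 <= n%:R * (e ^+ 2 / 3) by rewrite mulr_ge0 // divr_ge0 // sqr_ge0.
  by set A := n%:R * _; set B := n%:R * _; nra.
have -> : e * (1 + n%:R * (e ^+ 2 / 3)) = e + n%:R * e ^+ 3 / 3 by field.
lra.
Qed.

Lemma cbrt_exists (t : R) : 0 <= t <= 1 -> exists2 r, 0 <= r <= 1 & r ^+ 3 = t.
Proof.
move=> /andP[t0 t1]; exists (t `^ 3^-1).
  rewrite powR_ge0 /=; have := @ge0_ler_powR R 3^-1.
  by move=> /(_ _ t 1); rewrite powR1 !nnegrE; apply; rewrite ?invr_ge0.
by rewrite -powR_mulrn ?powR_ge0 // -powRrM mulVf ?powRr1.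
Qed.

(* P_(n+1) = P_n + (x^2 - P_n^2) / 2 increases to |x| for |x| <= 1; here x = u - l. *)
Fixpoint abs_poly (l : R) n : {poly R} :=
  if n is m.+1 then abs_poly l m + 2^-1 *: (('X - l%:P) ^+ 2 - abs_poly l m ^+ 2) else 0.

Lemma abs_poly_err (l u : R) n : `|u - l| <= 1 ->
  let P := (abs_poly l n).[u] in
  [/\ 0 <= P, P <= `|u - l| & n%:R * (`|u - l| - P) <= 2].
Proof.
move=> x1; set x := `|u - l| in x1 *.
have x0 : 0 <= x by rewrite normr_ge0.
suff : let P := (abs_poly l n).[u] in
    [/\ 0 <= P, P <= x & (x - P) * (1 + n%:R * (x / 2)) <= x].
  move=> /= [P0 Px h]; split=> //; have n0 := ler0n R n.
  move: h; set P := _.[_] in P0 Px *.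
  have [->|xn] := eqVneq x 0; first by move: Px; nra.
  have xp : 0 < x by rewrite lt_def xn.
  by move=> h; have : x * (n%:R * (x - P)) <= x * 2; [nra | rewrite ler_pM2l].
elim: n => [|n] /=.
  by rewrite horner0 subr0 mul0r addr0 mulr1.
set P := (abs_poly l n).[_] => -[P0 Pr IH].
have -> : (abs_poly l n + 2^-1 *: (('X - l%:P) ^+ 2 - abs_poly l n ^+ 2)).[u] =
    P + (x ^+ 2 - P ^+ 2) / 2.
  by rewrite !hornerE -/P /x -normrX ger0_norm ?sqr_ge0 //; ring.
set P' := P + _.
have E1 : x - P' = (x - P) * (1 - (x + P) / 2) by rewrite /P'; field.
have PP : 0 <= x ^+ 2 - P ^+ 2 by rewrite subr_ge0 ler_pXn2r ?nnegrE.
split; first by rewrite addr_ge0 // divr_ge0.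
  by rewrite -subr_ge0 E1 mulr_ge0 ?subr_ge0 //; lra.
rewrite E1 -natr1; have n0 := ler0n R n.
apply: le_trans IH; rewrite -mulrA ler_wpM2l ?subr_ge0 //.
have x2 : 0 <= x / 2 by rewrite divr_ge0.
have : (1 - (x + P) / 2) * (1 + (n%:R + 1) * (x / 2)) <=
       (1 - x / 2) * (1 + (n%:R + 1) * (x / 2)).
  by rewrite ler_wpM2r ?addr_ge0 ?mulr_ge0 ?addr_ge0 //; lra.
move: x2; set s := x / 2; set S := (x + P) / 2 => s0.
have : 0 <= (n%:R + 1) * (s * s) by rewrite !mulr_ge0 ?addr_ge0.
lra.
Qed.

(** The index [n.+1] makes the error 1/(n+1): the bound 2/(n+1) from [abs_poly_err] is halved. *)
Definition pos_poly l n : {poly R} := 2^-1 *: (abs_poly l n.+1 + ('X - l%:P)).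
Definition neg_poly l n : {poly R} := 2^-1 *: (abs_poly l n.+1 - ('X - l%:P)).

Lemma pos_polyE (l u : R) n : (pos_poly l n).[u] = ((abs_poly l n.+1).[u] + (u - l)) / 2.
Proof. by rewrite /pos_poly; move: (abs_poly l n.+1) => q; rewrite !hornerE; ring. Qed.

Lemma neg_polyE (l u : R) n : (neg_poly l n).[u] = ((abs_poly l n.+1).[u] - (u - l)) / 2.
Proof. by rewrite /neg_poly; move: (abs_poly l n.+1) => q; rewrite !hornerE; ring. Qed.

Lemma pos_neg_poly_sub l n : pos_poly l n - neg_poly l n = 'X - l%:P.
Proof.
rewrite /pos_poly /neg_poly -scalerBr; move: (abs_poly l n.+1) ('X - l%:P) => q d.
rewrite opprB [q + d]addrC addrACA subrr addr0 -mulr2n -[d *+ 2]scaler_nat scalerA.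
by rewrite mulVf ?pnatr_eq0 // scale1r.
Qed.

Lemma pos_neg_poly_err (l u : R) n : 0 <= l <= 1 -> 0 <= u <= 1 ->
  [/\ `|(pos_poly l n).[u] - Num.max (u - l) 0| <= n.+1%:R^-1,
      `|(neg_poly l n).[u] - Num.max (l - u) 0| <= n.+1%:R^-1,
      `|(pos_poly l n).[u]| <= 1 &
      `|(pos_poly l n).[u] * (neg_poly l n).[u]| <= n.+1%:R^-1].
Proof.
move=> /andP[l0 l1] /andP[u0 u1].
have x1 : `|u - l| <= 1 by rewrite ler_norml; lra.
have [P0 Px h] := abs_poly_err n.+1 x1.
rewrite pos_polyE neg_polyE.
move: h P0 Px; set P := (abs_poly l n.+1).[u] => h P0 Px.
have {}h : (`|u - l| - P) / 2 <= n.+1%:R^-1.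
  rewrite -[X in _ <= X]mul1r ler_pdivlMr // mulrAC ler_pdivrMr // mul1r mulrC //.
have n1 : 0 < n.+1%:R^-1 :> R by rewrite invr_gt0.
move: (n.+1%:R^-1) n1 h => i n1 h.
split.
- rewrite ler_norml; move: h Px; have [d|d] := leP 0 (u - l).
    by rewrite ger0_norm //; lra.
  by rewrite ltr0_norm //; lra.
- rewrite ler_norml; move: h Px; have [d|d] := leP 0 (u - l).
    by rewrite max_r ?ger0_norm //; lra.
  by rewrite max_l ?ltr0_norm //; lra.
- rewrite ler_norml; move: h Px x1; have [d|d] := leP 0 (u - l).
    by rewrite ger0_norm //; lra.
  by rewrite ltr0_norm //; lra.
- have -> : (P + (u - l)) / 2 * ((P - (u - l)) / 2) =
      - ((`|u - l| - P) / 2 * ((`|u - l| + P) / 2)).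
    have [d|d] := leP 0 (u - l); first by rewrite ger0_norm //; field.
    by rewrite ltr0_norm //; field.
  rewrite normrN ger0_norm; last by rewrite mulr_ge0 //; lra.
  by apply: le_trans h; rewrite ler_piMr //; lra.
Qed.

End RealApproximation.

Lemma small_inv (R : realType) (e : R) : 0 < e ->
  exists M, forall n, (M <= n)%N -> n.+1%:R^-1 < e.
Proof.
move=> e0; exists (Num.bound `|e^-1|) => n hn.
rewrite -[e]invrK ltf_pV2 ?posrE ?invr_gt0 //.
apply: le_lt_trans (ler_norm _) _; apply: lt_le_trans (archi_boundP (normr_ge0 _)) _.
by rewrite ler_nat ltnW.
Qed.

Lemma nrm_tends (R : realType) (V : normedModType R[i]) (u : nat -> V) x :
  (forall n, nrm (u n - x) <= n.+1%:R^-1) -> tends u x.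
Proof.
move=> h e /small_inv[M hM]; exists M => n /hM; exact: le_lt_trans (h n).
Qed.

(** * Spectral splitting and cube roots in a JB*-triple *)

Section JBstarCalculus.
Variables (R : realType) (E : completeNormedModType R[i]) (tp : E -> E -> E -> E).
Hypothesis hE : JBstar_triple tp.

Let jt : jordan_triple tp := jbt_jordan (jbs_banach hE).
Let tpC := jbt_continuous (jbs_banach hE).

Lemma jbs_bound : exists2 K : R, 0 < K &
  forall a b c, nrm (tp a b c) <= K * nrm a * nrm b * nrm c.
Proof.
apply: trihomogeneous_bounded tpC => r a b c.
- by rewrite (tpZl jt).
- by rewrite (tpZm jt) conj_realC.
- by rewrite (tpZr jt).
Qed.

Lemma jbs_cube a : nrm (tp a a a) = nrm a ^+ 3.
Proof. by apply: complexI; rewrite -nrmE (jbs_norm hE) nrmE rmorphXn. Qed.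

(** Outside the spectrum there is a continuous inverse [S], and [g] is the reciprocal of a bound for
    it. *)
Lemma jbs_lower a (z : R[i]) : ~~ (0 <= z) ->
  exists2 g : R, 0 < g & forall b, g * nrm b <= nrm (tp a a b - z *: b).
Proof.
move=> z0; have /contrapT[S [lS cS SK _]] : ~ op_spectrum (tp a a) z.
  by move=> /(jbs_spectrum hE); apply/negP.
have S0 : S 0 = 0.
  by have := lS 1 0 0; rewrite !scale1r addr0 -[X in X = _]addr0 => /addrI.
have [||G G0 hG] := @homogeneous_bounded _ _ _ S.
- by move=> r x; have := lS r%:C x 0; rewrite S0 !addr0.
- exact: cS.
exists G^-1; first by rewrite invr_gt0.
by move=> b; rewrite mulrC ler_pdivrMr // mulrC -{1}[b]SK.
Qed.

Lemma jbs_pev_sup a (x : {poly R}) m : nrm a <= 1 -> 0 <= m ->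
  (forall t : R, 0 <= t <= 1 -> `|t * x.[t ^+ 2]| <= m) ->
  nrm (pev (tpow tp a) (rpoly x)) <= m.
Proof.
move=> a1 m0 hm; have [K _ hK] := jbs_bound.
exact: (pev_sup jt hK jbs_cube a1 (@jbs_lower a) m0 hm).
Qed.

Lemma jbs_pev_unif a (x : {poly R}) m : nrm a <= 1 -> 0 <= m ->
  (forall u : R, 0 <= u <= 1 -> `|x.[u]| <= m) ->
  nrm (pev (tpow tp a) (rpoly x)) <= m.
Proof.
move=> a1 m0 hm; apply: jbs_pev_sup => // t /andP[t0 t1].
rewrite normrM (ger0_norm t0).
have := hm (t ^+ 2); rewrite sqr_ge0 expr_le1 // t1 => /(_ isT).
by have := normr_ge0 x.[t ^+ 2]; nra.
Qed.

Lemma pev_tends_exists a (p : nat -> {poly R}) (phi : R -> R) : nrm a <= 1 ->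
  (forall n u, 0 <= u <= 1 -> `|(p n).[u] - phi u| <= n.+1%:R^-1) ->
  exists x, tends (fun n => pev (tpow tp a) (rpoly (p n))) x.
Proof.
move=> a1 hp; apply: ncauchy_tends => e e0.
have [M hM] : exists M, forall n, (M <= n)%N -> n.+1%:R^-1 < e / 2 by apply: small_inv; lra.
exists M => m n /hM Mm /hM Mn.
rewrite pev_rpolyB; apply: (@le_lt_trans _ _ (m.+1%:R^-1 + n.+1%:R^-1)); last by rewrite [X in _ < X](splitr e) ltrD.
apply: jbs_pev_unif => // u u01.
rewrite hornerD hornerN -(subrKA (phi u)); apply: le_trans (ler_normD _ _) _.
by apply: lerD; [|rewrite distrC]; exact: hp.
Qed.

Lemma pev_tends_dist a (p q : nat -> {poly R}) (phi psi : R -> R) x y m : nrm a <= 1 -> 0 <= m ->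
  (forall n u, 0 <= u <= 1 -> `|(p n).[u] - phi u| <= n.+1%:R^-1) ->
  (forall n u, 0 <= u <= 1 -> `|(q n).[u] - psi u| <= n.+1%:R^-1) ->
  (forall u, 0 <= u <= 1 -> `|phi u - psi u| <= m) ->
  tends (fun n => pev (tpow tp a) (rpoly (p n))) x ->
  tends (fun n => pev (tpow tp a) (rpoly (q n))) y -> nrm (x - y) <= m.
Proof.
move=> a1 m0 hp hq hm px qy; apply/ler_addgt0Pr => e e0.
have [M hM] : exists M, forall n, (M <= n)%N -> n.+1%:R^-1 < e / 4 by apply: small_inv; lra.
have e4 : 0 < e / 4 by lra.
have [N1 h1] := px _ e4; have [N2 h2] := qy _ e4.
pose n := maxn M (maxn N1 N2).
have := hM n (leq_maxl _ _).
have := h1 n (leq_trans (leq_maxl _ _) (leq_maxr _ _)).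
have := h2 n (leq_trans (leq_maxr _ _) (leq_maxr _ _)).
set Q := pev _ _; set P := pev _ _ => hy hx hn.
have : nrm (Q - P) <= m + n.+1%:R^-1 + n.+1%:R^-1.
  rewrite /P /Q pev_rpolyB; apply: jbs_pev_unif => // [|u u01].
    by rewrite !addr_ge0.
  rewrite hornerD hornerN.
  have := hp n u u01; have := hq n u u01; have := hm u u01.
  by move: (n.+1%:R^-1) => i; rewrite !ler_norml; lra.
move: (n.+1%:R^-1) hn => i hn.
have := nrm_triangle P x y; have := nrm_triangle Q P y.
rewrite (nrm_distC x P) (nrm_distC P Q); lra.
Qed.

(** By [tpow_L] the box operator of two powers depends only on the sum of their indices. *)
Lemma pev_box a (p q : {poly R[i]}) z :
  tp (pev (tpow tp a) p) (pev (tpow tp a) q) z =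
  pev (fun k => tp (tpow tp a k) a z) (p * conjp q).
Proof.
have pdef (s : {poly R[i]}) : s = \sum_(k < size s) s`_k *: 'X^k by rewrite -poly_def coefK.
rewrite [in RHS](pdef p) [in RHS](pdef q).
rewrite [in RHS]/conjp (rmorph_sum (map_poly (@Num.conj R[i]))).
rewrite !mulr_suml linear_sum /= [X in tp X _ _]/pev (tp_suml jt); apply: eq_bigr => i _.
rewrite mulr_sumr linear_sum /= [X in tp _ X _]/pev (tp_summ jt); apply: eq_bigr => j _.
rewrite linearZ /= map_polyXn -!scalerAl -!scalerAr.
rewrite !linearZ /= -exprD pevXn (tpZl jt) (tpZm jt).
by rewrite (@tpow_L _ _ _ (tp_add_triple jt) a (i + j) i j (i + j) 0) ?addn0.
Qed.

Lemma pev_box_assoc a (p q r s : {poly R[i]}) z :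
  let ev := pev (tpow tp a) in
  tp (tp (ev p) (ev q) (ev r)) (ev s) z = tp (ev p) (tp (ev q) (ev r) (ev s)) z.
Proof.
move=> ev; rewrite /ev !(pev_triple jt) !pev_box; congr pev.
by rewrite !rmorphM /= conjpK conjpX; ring.
Qed.

Definition orth x y := (forall z, tp x y z = 0) /\ (forall z, tp y x z = 0).

Lemma tends_tp u v w x y z : tends u x -> tends v y -> tends w z ->
  tends (fun n => tp (u n) (v n) (w n)) (tp x y z).
Proof. exact: tends_tri. Qed.

(** As functions of t, f l is t max(t^2 - l, 0) and g l is t max(l - t^2, 0). The cube occurs
    because [pev_box_assoc] turns L({f,f,f},g) into L(f,{f,f,g}), where {f,f,g} = 0. The last clause
    places both parts in every closed set containing the odd polynomials in [a]. *)
Lemma spectral_split a : nrm a <= 1 -> exists f g : R -> E,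
  [/\ forall l, 0 <= l <= 1 -> f l - g l = tp a a a - l%:C *: a,
      forall l m, 0 <= l <= 1 -> 0 <= m <= 1 ->
        nrm (f l - f m) <= `|l - m| /\ nrm (g l - g m) <= `|l - m|,
      f 1 = 0 /\ g 0 = 0,
      forall l, 0 <= l <= 1 -> orth (tp (f l) (f l) (f l)) (g l) &
      forall (A : set E) l, 0 <= l <= 1 ->
        (forall u x, (forall n, A (u n)) -> tends u x -> A x) ->
        (forall p, A (pev (tpow tp a) p)) -> A (f l) /\ A (g l)].
Proof.
move=> a1.
have err l n u := @pos_neg_poly_err R l u n.
have [f hf] : exists f : R -> E, forall l, 0 <= l <= 1 ->
    tends (fun n => pev (tpow tp a) (rpoly (pos_poly l n))) (f l).
  suff h l : exists y, 0 <= l <= 1 -> tends (fun n => pev (tpow tp a) (rpoly (pos_poly l n))) y.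
    by have [h' hh'] := choice h; exists h'.
  have [l01|] := boolP (0 <= l <= 1); last by exists 0.
  have [x hx] := @pev_tends_exists a (pos_poly l) (fun u => Num.max (u - l) 0) a1
    (fun n u u01 => let: And4 h _ _ _ := err l n u l01 u01 in h).
  by exists x.
have [g hg] : exists g : R -> E, forall l, 0 <= l <= 1 ->
    tends (fun n => pev (tpow tp a) (rpoly (neg_poly l n))) (g l).
  suff h l : exists y, 0 <= l <= 1 -> tends (fun n => pev (tpow tp a) (rpoly (neg_poly l n))) y.
    by have [h' hh'] := choice h; exists h'.
  have [l01|] := boolP (0 <= l <= 1); last by exists 0.
  have [x hx] := @pev_tends_exists a (neg_poly l) (fun u => Num.max (l - u) 0) a1
    (fun n u u01 => let: And4 _ h _ _ := err l n u l01 u01 in h).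
  by exists x.
have max_lip (x y : R) : `|Num.max x 0 - Num.max y 0| <= `|x - y|.
  rewrite ler_norml; have [d|d] := leP 0 (x - y).
    rewrite ger0_norm //; case: (leP x 0) => ?; case: (leP y 0) => ?; lra.
  rewrite ltr0_norm //; case: (leP x 0) => ?; case: (leP y 0) => ?; lra.
have i01 : 0 <= (1 : R) <= 1 by rewrite ler01 lexx.
have o01 : 0 <= (0 : R) <= 1 by rewrite ler01 lexx.
have zero_tends : tends (fun n : nat => pev (tpow tp a) (rpoly 0)) 0.
  by rewrite rmorph0 linear0; exact: tends_cst.
exists f, g; split.
- move=> l l01; apply: (tends_uniq (tendsB (hf l l01) (hg l l01))).
  have -> : (fun n => pev (tpow tp a) (rpoly (pos_poly l n)) - pev (tpow tp a) (rpoly (neg_poly l n))) =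
      (fun=> tp a a a - l%:C *: a); last exact: tends_cst.
  apply/funext => n; rewrite pev_rpolyB pos_neg_poly_sub -pev_rpolyB rpolyX.
  rewrite /rpoly map_polyC /= -alg_polyC [X in _ - X]linearZ /= pev1.
  by have := pevXn (tpow tp a) 1; rewrite expr1 => ->.
- move=> l m l01 m01; split.
    apply: (pev_tends_dist a1 (normr_ge0 _) _ _ _ (hf l l01) (hf m m01)).
    + by move=> n u u01; have [h _ _ _] := err l n u l01 u01; exact: h.
    + by move=> n u u01; have [h _ _ _] := err m n u m01 u01; exact: h.
    + move=> u u01 /=; apply: le_trans (max_lip _ _) _.
      by rewrite opprB addrC subrKA distrC.
  apply: (pev_tends_dist a1 (normr_ge0 _) _ _ _ (hg l l01) (hg m m01)).
  + by move=> n u u01; have [_ h _ _] := err l n u l01 u01; exact: h.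
  + by move=> n u u01; have [_ h _ _] := err m n u m01 u01; exact: h.
  + move=> u u01 /=; apply: le_trans (max_lip _ _) _.
    by rewrite opprB addrA subrK.
- split.
    apply: nrm0_eq0; apply/eqP; rewrite eq_le nrm_ge0 andbT -[f 1]subr0.
    apply: (pev_tends_dist (psi := fun=> 0) a1 (lexx 0) _ _ _ (hf 1 i01) zero_tends).
    + by move=> n u u01; have [h _ _ _] := err 1 n u i01 u01; exact: h.
    + by move=> n u u01; rewrite horner0 subrr normr0 invr_ge0.
    + by move=> u /andP[u0 u1]; rewrite max_r ?subr_le0 // subrr normr0.
  apply: nrm0_eq0; apply/eqP; rewrite eq_le nrm_ge0 andbT -[g 0]subr0.
  apply: (pev_tends_dist (psi := fun=> 0) a1 (lexx 0) _ _ _ (hg 0 o01) zero_tends).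
  + by move=> n u u01; have [_ h _ _] := err 0 n u o01 u01; exact: h.
  + by move=> n u u01; rewrite horner0 subrr normr0 invr_ge0.
  + by move=> u /andP[u0 u1]; rewrite subr0 max_r ?normr0 // sub0r oppr_le0.
- move=> l l01; have hf' := hf l l01; have hg' := hg l l01.
  have ffg : tp (f l) (f l) (g l) = 0.
    apply: (tends_uniq (tends_tp hf' hf' hg')); apply: nrm_tends => n.
    rewrite subr0 (pev_triple jt) conjp_rpoly -rpolyX -!rmorphM /=.
    apply: jbs_pev_unif => // u u01; have [_ _ h1 h2] := err l n u l01 u01.
    have [u0 u1] := andP u01; rewrite !hornerM hornerX.
    move: h1 h2; set P := _.[u]; set Q := _.[u] => h1 h2.
    rewrite (_ : P * P * Q * u = u * P * (P * Q)); last by ring.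
    rewrite [`|u * P * _|]normrM [`|u * P|]normrM (ger0_norm u0).
    apply: le_trans h2; rewrite ler_piMl ?normr_ge0 //.
    by have := normr_ge0 P; nra.
  have boxL (x1 x2 x3 x4 : nat -> {poly R[i]}) y1 y2 y3 y4 z :
      tends (fun n => pev (tpow tp a) (x1 n)) y1 -> tends (fun n => pev (tpow tp a) (x2 n)) y2 ->
      tends (fun n => pev (tpow tp a) (x3 n)) y3 -> tends (fun n => pev (tpow tp a) (x4 n)) y4 ->
      tp (tp y1 y2 y3) y4 z = tp y1 (tp y2 y3 y4) z.
    move=> t1 t2 t3 t4; apply: (tends_uniq (tends_tp (tends_tp t1 t2 t3) t4 (tends_cst z))).
    have := tends_tp t1 (tends_tp t2 t3 t4) (tends_cst z).
    by congr (tends _ _); apply/funext => k; rewrite pev_box_assoc.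
  split=> z; first by rewrite (boxL _ _ _ _ _ _ _ _ z hf' hf' hf' hg') ffg (tp0m jt).
  by rewrite -(boxL _ _ _ _ _ _ _ _ z hg' hf' hf' hf') (jt_sym jt (g l)) ffg (tp0l jt).
- move=> A l l01 cA hA; split.
    by apply: (cA _ _ _ (hf l l01)) => n; exact: hA.
  by apply: (cA _ _ _ (hg l l01)) => n; exact: hA.
Qed.

(** The third clause makes [a] a limit of odd polynomials starting at the cube; [J_unroot] depends
    on it. *)
Lemma cube_root_pev a : nrm a <= 1 -> exists c (u : nat -> {poly R}),
  [/\ tp c c c = a, tends (fun n => pev (tpow tp a) (rpoly (u n))) c &
      tends (fun n => pev (tpow tp a) (rpoly ('X * u n ^+ 3))) a].
Proof.
move=> a1.
pose u := @cbrt_poly R.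
have [c hc] : exists c, tends (fun n => pev (tpow tp a) (rpoly (u n))) c.
  apply: ncauchy_tends => e e0; have e4 : 0 < e / 4 by lra.
  have [M hM] := cbrt_poly_unif e4; exists M => m n Mm Mn.
  rewrite pev_rpolyB; apply: (@le_lt_trans _ _ (e / 2)); last lra.
  apply: jbs_pev_sup => // [|t t01]; first lra.
  have [r r01 <-] := cbrt_exists t01.
  have := hM m Mm r r01; have := hM n Mn r r01.
  rewrite hornerD hornerN mulrDr mulrN !ler_norml; lra.
have h3 : tends (fun n => pev (tpow tp a) (rpoly ('X * u n ^+ 3))) a.
  (* The tolerance 1 keeps |P| <= 2, so that |P^2 + P r + r^2| <= 7, and 7e/20 <= e/2. *)
  move=> e e0; have e4 : 0 < Num.min (e / 20) 1 by rewrite lt_min ltr01 andbT; lra.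
  have [M hM] := cbrt_poly_unif e4; exists M => n Mn.
  have {2}-> : a = pev (tpow tp a) (rpoly 1) by rewrite rmorph1 pev1.
  rewrite pev_rpolyB; apply: (@le_lt_trans _ _ (e / 2)); last lra.
  apply: jbs_pev_sup => // [|t t01]; first lra.
  have [r r01 <-] := cbrt_exists t01; have [r0 r1] := andP r01.
  have := hM n Mn r r01; rewrite -/u le_min.
  have -> : ('X * u n ^+ 3 - 1).[r ^+ 3 ^+ 2] = r ^+ 3 ^+ 2 * (u n).[r ^+ 3 ^+ 2] ^+ 3 - 1.
    by move: (u n) (r ^+ 3 ^+ 2) => q w; rewrite !hornerE; ring.
  set Q := (u n).[_]; set P := r ^+ 3 * Q => /andP[h1 h2].
  have -> : r ^+ 3 * (r ^+ 3 ^+ 2 * Q ^+ 3 - 1) = (P - r) * (P ^+ 2 + P * r + r ^+ 2).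
    by rewrite /P; ring.
  have : `|P ^+ 2 + P * r + r ^+ 2| <= 7.
    by move: h2; rewrite !ler_norml; nra.
  rewrite normrM; move: h1; have := normr_ge0 (P - r).
  have := normr_ge0 (P ^+ 2 + P * r + r ^+ 2).
  set A := `|P - r|; set B := `|_|; nra.
exists c, u; split=> //.
apply: (tends_uniq (tends_tp hc hc hc)); move: h3; congr (tends _ _).
apply/funext => n; rewrite (pev_triple jt) conjp_rpoly -rpolyX -!rmorphM /=.
by congr (pev _ (rpoly _)); ring.
Qed.

End JBstarCalculus.

(** * Separating spaces *)

Section Geometric.
Variable R : realType.

Lemma expV2_gt0 n : 0 < (2^-1 : R) ^+ n.
Proof. by rewrite exprn_gt0. Qed.

Lemma small_expV2 (e : R) : 0 < e -> exists M, forall n, (M <= n)%N -> (2^-1) ^+ n < e.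
Proof.
move=> /small_inv[M hM]; exists M => n /hM; apply: le_lt_trans.
rewrite exprVn lef_pV2 ?posrE ?exprn_gt0 // -natrX ler_nat.
exact: ltn_expl.
Qed.

Lemma geometric_tends (V : completeNormedModType R[i]) (u : nat -> V) (c : R) : 0 <= c ->
  (forall n, nrm (u n.+1 - u n) <= c * 2^-1 ^+ n) ->
  exists2 l, tends u l & forall n, nrm (l - u n) <= 2 * c * 2^-1 ^+ n.
Proof.
move=> c0 hu.
have hk n k : nrm (u (n + k)%N - u n) <= 2 * c * 2^-1 ^+ n - 2 * c * 2^-1 ^+ (n + k).
  elim: k => [|k IH]; first by rewrite addn0 !subrr nrm0.
  apply: le_trans (nrm_triangle (u (n + k)%N) _ _) _.
  have := hu (n + k)%N; rewrite !addnS exprS; lra.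
have hb n m : (n <= m)%N -> nrm (u m - u n) <= 2 * c * 2^-1 ^+ n.
  move=> nm; have := hk n (m - n)%N; rewrite subnKC // => h; apply: le_trans h _.
  by rewrite gerBl !mulr_ge0 // ltW // expV2_gt0.
have [l ul] : exists l, tends u l.
  apply: ncauchy_tends => e e0.
  have d0 : 0 < e / (4 * c + 1) by rewrite divr_gt0 //; lra.
  have [M hM] := small_expV2 d0; exists M => m n Mm Mn.
  apply: le_lt_trans (nrm_triangle (u M) _ _) _; rewrite (nrm_distC (u M)).
  have := hb M m Mm; have := hb M n Mn; have := hM M (leqnn _); have := expV2_gt0 M.
  by rewrite ltr_pdivlMr; [nra | lra].
exists l => // n.
have h : tends (fun m => u (m + n)%N - u n) (l - u n).
  by apply: tendsB; [exact: tends_shift | exact: tends_cst].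
by apply: (tends_le_nrm h) => m; apply: hb; exact: leq_addl.
Qed.

(* The library's Baire theorem is about real scalars, not R[i]. *)
Lemma baire_cover (V : completeNormedModType R[i]) (A : nat -> set V) :
  (forall x, exists n, A n x) ->
  exists n x0 r, 0 < r /\ forall y e, nrm (y - x0) < r -> 0 < e ->
    exists2 v, A n v & nrm (y - v) < e.
Proof.
move=> cov; apply: contrapT => noball.
have step n (p : V * R) : exists q : V * R, 0 < p.2 ->
    [/\ 0 < q.2, nrm (q.1 - p.1) + q.2 <= p.2, q.2 <= p.2 / 2 &
        forall v, nrm (v - q.1) <= q.2 -> ~ A n v].
  have [p0|p0] := ltP 0 p.2; last by exists p.
  apply: contrapT => nq; apply: noball; exists n, p.1, (p.2); split=> // y e yp e0.
  apply: contrapT => nv; apply: nq.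
  (* The three radii serve to miss [A n], to stay inside the old ball and to halve its radius. *)
  exists (y, Num.min (e / 2) (Num.min ((p.2 - nrm (y - p.1)) / 2) (p.2 / 2))) => _ /=.
  have e2 : 0 < e / 2 by lra.
  have d2 : 0 < (p.2 - nrm (y - p.1)) / 2 by lra.
  have p2 : 0 < p.2 / 2 by lra.
  set m1 := e / 2 in e2 *; set m2 := (_ - _) / 2 in d2 *; set m3 := p.2 / 2 in p2 *.
  split.
  - by rewrite !lt_min e2 d2 p2.
  - have : Num.min m1 (Num.min m2 m3) <= m2 by rewrite !ge_min lexx orbT.
    by rewrite /m2; lra.
  - by rewrite !ge_min lexx !orbT.
  - move=> v; rewrite le_min => /andP[h _] Av; apply: nv; exists v => //.
    by rewrite nrm_distC; apply: le_lt_trans h _; rewrite /m1; lra.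
have [F hF] : exists F : nat -> V * R -> V * R, forall n p, 0 < p.2 ->
    [/\ 0 < (F n p).2, nrm ((F n p).1 - p.1) + (F n p).2 <= p.2, (F n p).2 <= p.2 / 2 &
        forall v, nrm (v - (F n p).1) <= (F n p).2 -> ~ A n v].
  have [F hF] := choice (fun np : nat * (V * R) => step np.1 np.2).
  by exists (fun n p => F (n, p)) => n p; exact: (hF (n, p)).
pose st := fix st n := if n is m.+1 then F m (st m) else ((0 : V), (1 : R)).
have st0 n : 0 < (st n).2 by elim: n => //= n IH; have [] := hF n _ IH.
have st_exp n : (st n).2 <= 2^-1 ^+ n.
  by elim: n => [|n IH] //=; have [_ _ h _] := hF n _ (st0 n); rewrite exprS; lra.
have st_nest n k : nrm ((st (n + k)%N).1 - (st n).1) + (st (n + k)%N).2 <= (st n).2.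
  elim: k => [|k IH]; first by rewrite addn0 subrr nrm0 add0r.
  rewrite addnS /=; have [_ h _ _] := hF (n + k)%N _ (st0 (n + k)%N).
  have := nrm_triangle (st (n + k)%N).1 (F (n + k)%N (st (n + k)%N)).1 (st n).1; lra.
have [||l hl _] := @geometric_tends V (fun n => (st n).1) 1.
- by [].
- move=> n; have [_ h _ _] := hF n _ (st0 n); rewrite mul1r.
  have := st_exp n; have := st0 n.+1; rewrite /=; lra.
have hin n : nrm (l - (st n).1) <= (st n).2.
  have h : tends (fun m => (st (m + n)%N).1 - (st n).1) (l - (st n).1).
    by apply: tendsB; [exact: (tends_shift n hl) | exact: tends_cst].
  apply: (tends_le_nrm h) => m; rewrite addnC; have := st_nest n m.
  have := st0 (n + m)%N; lra.
have [N AN] := cov l.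
have [_ _ _ h] := hF N _ (st0 N).
exact: (h l (hin N.+1)).
Qed.

End Geometric.

Section Separating.
Variables (R : realType) (E X : completeNormedModType R[i]) (delta : E -> X).
Hypothesis dD : forall x y, delta (x + y) = delta x + delta y.
Hypothesis dZ : forall (r : R) x, delta (r%:C *: x) = r%:C *: delta x.

Local Notation sep := (separating_space delta).

Lemma dlt0 : delta 0 = 0.
Proof. by have := dZ 0 0; rewrite !scale0r. Qed.

Lemma dltN x : delta (- x) = - delta x.
Proof. by apply: (addrI (delta x)); rewrite -dD !subrr dlt0. Qed.

Lemma dltB x y : delta (x - y) = delta x - delta y.
Proof. by rewrite dD dltN. Qed.

Lemma sepP z : sep z <-> exists2 u : nat -> E, tends u 0 & tends (fun n => delta (u n)) z.
Proof.
split=> [[u [h1 h2]]|[u h1 h2]]; exists u; [exact/tendsP | exact/tendsP |].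
by split; [exact/tendsP | exact/(tendsP (fun n => delta (u n)))].
Qed.

Lemma sep0 : sep 0.
Proof.
by apply/sepP; exists (fun=> 0); [exact: tends_cst | rewrite dlt0; exact: tends_cst].
Qed.

Lemma sepD x y : sep x -> sep y -> sep (x + y).
Proof.
move=> /sepP[u u0 ux] /sepP[v v0 vy]; apply/sepP; exists (fun n => u n + v n).
  by have := tendsD u0 v0; rewrite addr0.
have -> : (fun n => delta (u n + v n)) = (fun n => delta (u n) + delta (v n)).
  by apply/funext => n; rewrite dD.
exact: tendsD.
Qed.

Lemma sepZ (r : R) x : sep x -> sep (r%:C *: x).
Proof.
move=> /sepP[u u0 ux]; apply/sepP; exists (fun n => r%:C *: u n).
  by have := tends_scale r%:C u0; rewrite scaler0.
have -> : (fun n => delta (r%:C *: u n)) = (fun n => r%:C *: delta (u n)).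
  by apply/funext => n; rewrite dZ.
exact: tends_scale.
Qed.

Lemma sepB x y : sep x -> sep y -> sep (x - y).
Proof.
move=> sx sy; apply: sepD => //.
have -> : - y = (-1)%:C *: y by rewrite rmorphN rmorph1 scaleN1r.
exact: sepZ.
Qed.

(** By [baire_cover], the points whose image is within some n of [sep] are dense in a ball.
    Differences move the ball to the origin, and scaling makes the bound homogeneous. *)
Lemma sep_approx : exists2 C : R, 0 < C & forall y e, 0 < e ->
  exists v s, [/\ sep s, nrm (y - v) < e & nrm (delta v - s) <= C * nrm y].
Proof.
pose A n := [set x | exists2 s, sep s & nrm (delta x - s) <= n%:R].
have [x|n [x0 [r [r0 hr]]]] := @baire_cover R E A.
  exists (Num.bound `|nrm (delta x)|), 0; first exact: sep0.
  rewrite subr0; apply: le_trans (ler_norm _) _.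
  exact: (ltW (archi_boundP (normr_ge0 _))).
have hr0 y e : nrm y < r -> 0 < e ->
    exists v s, [/\ sep s, nrm (y - v) < e & nrm (delta v - s) <= 2 * n%:R].
  move=> yr e0; have e2 : 0 < e / 2 by lra.
  have [|v1 [s1 ss1 h1] g1] := hr (x0 + y) _ _ e2; first by rewrite addrC addKr.
  have [|v2 [s2 ss2 h2] g2] := hr x0 _ _ e2; first by rewrite subrr nrm0.
  exists (v1 - v2), (s1 - s2); split; first exact: sepB.
    have -> : y - (v1 - v2) = (x0 + y - v1) - (x0 - v2).
      by rewrite !opprB [RHS](AC (3*2) ((1*5)*(2*(4*3)))) /= subrr add0r.
    by have := nrmB (x0 + y - v1) (x0 - v2); lra.
  have -> : delta (v1 - v2) - (s1 - s2) = (delta v1 - s1) - (delta v2 - s2).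
    by rewrite dltB !opprB (AC (2*2) ((1*4)*(3*2))) /=.
  have := nrmB (delta v1 - s1) (delta v2 - s2); lra.
have n0 := ler0n R n; pose C := 2 * n%:R / (r / 2) + 1.
exists C; first by rewrite ltr_wpDl // divr_ge0 ?mulr_ge0 //; lra.
move=> y e e0; have [/nrm0_eq0 ->|yn] := eqVneq (nrm y) 0.
  by exists 0, 0; split; [exact: sep0 | rewrite subr0 nrm0 | rewrite dlt0 subr0 !nrm0 mulr0].
have yp : 0 < nrm y by rewrite lt_def yn nrm_ge0.
pose k := r / 2 / nrm y; have k0 : 0 < k by rewrite !divr_gt0.
have ky : nrm (k%:C *: y) < r by rewrite nrmZR (gtr0_norm k0) divfK //; lra.
have [|v [s [ss h1 h2]]] := hr0 _ (k * e) ky; first by rewrite mulr_gt0.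
have kV : 0 < k^-1 by rewrite invr_gt0.
exists (k^-1%:C *: v), (k^-1%:C *: s); split; first exact: sepZ.
  have -> : y - k^-1%:C *: v = k^-1%:C *: (k%:C *: y - v).
    by rewrite scalerBr scalerA -rmorphM /= mulVf ?gt_eqF // scale1r.
  by rewrite nrmZR gtr0_norm // -ltr_pdivlMl // invrK.
rewrite dZ -scalerBr nrmZR gtr0_norm //.
have : k^-1 * nrm (delta v - s) <= k^-1 * (2 * n%:R) by rewrite ler_pM2l.
move=> /le_trans; apply; rewrite /C /k mulrDl mul1r.
rewrite (_ : (r / 2 / nrm y)^-1 * _ = 2 * n%:R / (r / 2) * nrm y); first lra.
by field; rewrite yn gt_eqF.
Qed.

(* The induced map into the quotient by the separating space has a closed graph,
   hence is bounded. *)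
Lemma sep_bounded : exists2 K : R, 0 < K & forall x, exists2 s, sep s & nrm (delta x - s) <= K * nrm x.
Proof.
have [C C0 hC] := sep_approx; exists (2 * C); first by rewrite mulr_gt0.
move=> x; have [/nrm0_eq0 ->|xn] := eqVneq (nrm x) 0.
  by exists 0; [exact: sep0 | rewrite dlt0 subr0 !nrm0 mulr0].
have xp : 0 < nrm x by rewrite lt_def xn nrm_ge0.
have [G hG] : exists G : E * R -> E * X, forall ye, 0 < ye.2 ->
    [/\ sep (G ye).2, nrm (ye.1 - (G ye).1) < ye.2 &
        nrm (delta (G ye).1 - (G ye).2) <= C * nrm ye.1].
  suff h (ye : E * R) : exists vs : E * X, 0 < ye.2 ->
      [/\ sep vs.2, nrm (ye.1 - vs.1) < ye.2 & nrm (delta vs.1 - vs.2) <= C * nrm ye.1].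
    by have [h' hh'] := choice h; exists h'.
  have [e0|e0] := ltP 0 ye.2; last by exists (0, 0).
  by have [v [s h]] := hC ye.1 _ e0; exists (v, s).
pose ep n := nrm x * 2^-1 ^+ n.+1.
have ep0 n : 0 < ep n by rewrite mulr_gt0 // expV2_gt0.
(* [y n] is what remains of x after n approximations, x = v 0 + ... + v (n-1) + y n, with tolerances
   halved each time. *)
pose y := fix y n := if n is m.+1 then y m - (G (y m, ep m)).1 else x.
pose v n := (G (y n, ep n)).1; pose s n := (G (y n, ep n)).2.
have yS n : y n.+1 = y n - v n by [].
have hv n : [/\ sep (s n), nrm (y n.+1) < ep n & nrm (delta (v n) - s n) <= C * nrm (y n)].
  exact: (hG (y n, ep n) (ep0 n)).
have yb n : nrm (y n) <= nrm x * 2^-1 ^+ n.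
  by case: n => [|n]; [rewrite mulr1 | have [_ /ltW] := hv n].
pose S n := \sum_(i < n) s i; pose Y n := \sum_(i < n) (delta (v i) - s i).
have sS n : sep (S n).
  rewrite /S; elim: n => [|n IH]; first by rewrite big_ord0; exact: sep0.
  by rewrite big_ord_recr /=; apply: sepD => //; have [] := hv n.
have dy n : delta (y n) = delta x - Y n - S n.
  rewrite /Y /S; elim: n => [|n IH]; first by rewrite !big_ord0 !subr0.
  rewrite yS dltB IH !big_ord_recr /= !opprD !opprK !addrA.
  by rewrite [RHS](AC 6 (1*2*5*3*(4*6))) /= subrr addr0.
have [||L YL hL] := @geometric_tends R X Y (C * nrm x).
- by rewrite mulr_ge0 // ltW.
- move=> n; rewrite /Y big_ord_recr /= [X in nrm (X - _)]addrC addrK; have [_ _ h] := hv n.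
  by apply: le_trans h _; rewrite -mulrA ler_pM2l.
exists (delta x - L); last first.
  rewrite opprB addrC subrK.
  by have := hL 0%N; rewrite /Y big_ord0 subr0 mulr1 mulrA.
(* As [S n] lies in [sep], it is nearly the image of a small [w n]. Then y n + w n tends to 0 while
   its image tends to delta x - L. *)
have [w hw] : exists w : nat -> E, forall n, nrm (w n) <= n.+1%:R^-1 /\ nrm (delta (w n) - S n) <= n.+1%:R^-1.
  suff h n : exists w, nrm w <= n.+1%:R^-1 /\ nrm (delta w - S n) <= n.+1%:R^-1.
    by have [h' hh'] := choice h; exists h'.
  have /sepP[u u0 uS] := sS n; have i0 : 0 < n.+1%:R^-1 :> R by rewrite invr_gt0.
  have [N1 h1] := u0 _ i0; have [N2 h2] := uS _ i0.
  exists (u (maxn N1 N2)); split; apply: ltW.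
    by have := h1 _ (leq_maxl N1 N2); rewrite subr0.
  exact: h2 (leq_maxr N1 N2).
have w0 : tends w 0 by apply: nrm_tends => n; rewrite subr0; have [] := hw n.
have y0 : tends y 0.
  move=> e e0; have [|M hM] := @small_expV2 R (e / nrm x); first by rewrite divr_gt0.
  exists M => n /hM; rewrite subr0 ltr_pdivlMr // mulrC; exact: le_lt_trans.
apply/sepP; exists (fun n => y n + w n); first by have := tendsD y0 w0; rewrite addr0.
have -> : (fun n => delta (y n + w n)) = (fun n => (delta x - Y n) + (delta (w n) - S n)).
  by apply/funext => n; rewrite dD dy addrAC -addrA.
rewrite -[delta x - L]addr0; apply: tendsD; first by apply: tendsB => //; exact: tends_cst.
by apply: nrm_tends => n; rewrite subr0; have [] := hw n.
Qed.

End Separating.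

(** * Derivations of JB*-triples *)

Section LinearConj.
Variables (R : realType) (V W : lmodType R[i]) (f : V -> W).

Lemma linear_add : linear f -> forall x y, f (x + y) = f x + f y.
Proof. by move=> lf x y; have := lf 1 x y; rewrite !scale1r. Qed.

Lemma conj_linear_add : conj_linear f -> forall x y, f (x + y) = f x + f y.
Proof. by move=> lf x y; have := lf 1 x y; rewrite /= conjC1 !scale1r. Qed.

Lemma additive0 : (forall x y, f (x + y) = f x + f y) -> f 0 = 0.
Proof. by move=> fD; apply: (addrI (f 0)); rewrite -fD !addr0. Qed.

Lemma conj_linearZ : conj_linear f -> forall c x, f (c *: x) = Num.conj c *: f x.
Proof.
move=> lf c x; have f0 := additive0 (conj_linear_add lf).
by have := lf c x 0; rewrite /= f0 !addr0.
Qed.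

Lemma linear_scaleR : linear f -> forall (r : R) x, f (r%:C *: x) = r%:C *: f x.
Proof.
move=> lf r x; have f0 := additive0 (linear_add lf).
by have := lf r%:C x 0; rewrite f0 !addr0.
Qed.

Lemma conj_linear_scaleR : conj_linear f -> forall (r : R) x, f (r%:C *: x) = r%:C *: f x.
Proof. by move=> lf r x; rewrite (conj_linearZ lf) conj_realC. Qed.

End LinearConj.

(** * The split null extension and the fundamental formula for modules *)

Section TripleModule.
Variables (R : realType) (E X : lmodType R[i]) (tp : E -> E -> E -> E).
Variables (m1 : X -> E -> E -> X) (m2 : E -> X -> E -> X) (m3 : E -> E -> X -> X).
Hypotheses (jt : jordan_triple tp) (tm : triple_module tp m1 m2 m3).

Lemma m1Dl x y a b : m1 (x + y) a b = m1 x a b + m1 y a b.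
Proof. exact: (linear_add (tm1_linear_x tm a b)). Qed.
Lemma m1Dm x a b c : m1 x (a + b) c = m1 x a c + m1 x b c.
Proof. exact: (linear_add (tm1_linear_a tm x c)). Qed.
Lemma m1Dr x a b c : m1 x a (b + c) = m1 x a b + m1 x a c.
Proof. exact: (conj_linear_add (tm1_conj_b tm x a)). Qed.
Lemma m2Dl a b x c : m2 (a + b) x c = m2 a x c + m2 b x c.
Proof. exact: (conj_linear_add (tm2_conj_a tm x c)). Qed.
Lemma m2Dm a x y c : m2 a (x + y) c = m2 a x c + m2 a y c.
Proof. exact: (conj_linear_add (tm2_conj_x tm a c)). Qed.
Lemma m2Dr a x b c : m2 a x (b + c) = m2 a x b + m2 a x c.
Proof. exact: (conj_linear_add (tm2_conj_b tm a x)). Qed.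
Lemma m3Dl a b c x : m3 (a + b) c x = m3 a c x + m3 b c x.
Proof. exact: (conj_linear_add (tm3_conj_a tm c x)). Qed.
Lemma m3Dm a b c x : m3 a (b + c) x = m3 a b x + m3 a c x.
Proof. exact: (linear_add (tm3_linear_b tm a x)). Qed.
Lemma m3Dr a b x y : m3 a b (x + y) = m3 a b x + m3 a b y.
Proof. exact: (linear_add (tm3_linear_x tm a b)). Qed.

Lemma m2_0m a c : m2 a 0 c = 0.
Proof. exact: (additive0 (fun x y => m2Dm a x y c)). Qed.
Lemma m1_0l a b : m1 0 a b = 0.
Proof. exact: (additive0 (fun x y => m1Dl x y a b)). Qed.
Lemma m1_0r x a : m1 x a 0 = 0.
Proof. exact: (additive0 (m1Dr x a)). Qed.
Lemma m3_0l b x : m3 0 b x = 0.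
Proof. exact: (additive0 (fun a c => m3Dl a c b x)). Qed.
Lemma m3_0r a b : m3 a b 0 = 0.
Proof. exact: (additive0 (m3Dr a b)). Qed.

Lemma split_id_aux (V : zmodType) (a1 a2 a3 b1 b2 b3 c1 c2 c3 d1 d2 d3 e1 e2 e3 : V) :
  (a1 - a2 + a3) + (b1 - b2 + b3) + ((c1 - c2 + c3) + (d1 - d2 + d3) + (e1 - e2 + e3))
    - (c3 + d3 + (a3 + b3 + e3)) =
  (a1 + b1 + c1) + d1 + e1 - (c2 + (b2 + a2 + d2) + e2).
Proof.
rewrite !opprD.
rewrite [LHS](AC (3*3*(3*3*3)*(2*3))
  ((1*4*7*10*13)*(8*(5*2*11)*14)*(3*18)*(6*19)*(9*16)*(12*17)*(15*20))) /=.
by rewrite !subrr !addr0.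
Qed.

Lemma split_add_triple : add_triple (split_null_ext tp m1 m2 m3).
Proof.
split.
- move=> a a' b c; congr pair => /=; first exact: (tpDl jt).
  by rewrite m1Dl m2Dl m3Dl [LHS](AC (2*2*2) (1*3*5*(2*4*6))).
- move=> a b b' c; congr pair => /=; first exact: (tpDm jt).
  by rewrite m1Dm m2Dm m3Dm [LHS](AC (2*2*2) (1*3*5*(2*4*6))).
- move=> a b c c'; congr pair => /=; first exact: (tpDr jt).
  by rewrite m1Dr m2Dr m3Dr [LHS](AC (2*2*2) (1*3*5*(2*4*6))).
- move=> a b c; rewrite /split_null_ext (jt_sym jt) (tm_sym13 tm) (tm_sym2 tm).
  by rewrite -[m3 a.1 _ _](tm_sym13 tm) [LHS in (_, LHS)](AC 3 (3*2*1)).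
- move=> [a xa] [b xb] [x xx] [y xy] [z xz]; rewrite /split_null_ext /=.
  congr pair; first exact: (jt_identity jt).
  rewrite (tm_id_a tm) (tm_id_b tm) !m3Dr (tm_id_c tm a b) (tm_id_d tm a b) (tm_id_e tm a b).
  by rewrite !m1Dl !m2Dm; exact: split_id_aux.
Qed.

Lemma m2_fundamental a b s :
  m2 (tp b a b) s (tp b a b) = m2 b (m2 a (m2 b s b) a) b.
Proof.
have := at_fundamental split_add_triple (b, 0) (a, 0) (0, s).
rewrite /split_null_ext /= !(m1_0l, m1_0r, m3_0l, m3_0r, m2_0m, addr0, add0r).
by case.
Qed.

End TripleModule.

(** * Orthogonal complements as closed inner ideals *)

Section Orthogonality.
Variables (R : realType) (E : completeNormedModType R[i]) (tp : E -> E -> E -> E).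
Hypothesis hE : JBstar_triple tp.
Let jt : jordan_triple tp := jbt_jordan (jbs_banach hE).
Let ja := tp_add_triple jt.
Local Notation orth := (orth tp).

Lemma orth_sym x y : orth x y -> orth y x.
Proof. by case. Qed.

Lemma orthD b x y : orth b x -> orth b y -> orth b (x + y).
Proof.
move=> [h1 h2] [h3 h4]; split=> z.
  by rewrite (tpDm jt) h1 h3 addr0.
by rewrite (tpDl jt) h2 h4 addr0.
Qed.

Lemma orthZ b c x : orth b x -> orth b (c *: x).
Proof.
move=> [h1 h2]; split=> z; first by rewrite (tpZm jt) h1 scaler0.
by rewrite (tpZl jt) h2 scaler0.
Qed.

Lemma orth0 b : orth b 0.
Proof. by split=> z; rewrite ?(tp0m jt) ?(tp0l jt). Qed.

(** In the main identity and in [at_skew], every other term contains a vanishing box of b with x or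
    z. *)
Lemma orth_tp b x y z : orth b x -> orth b z -> orth b (tp x y z).
Proof.
move=> [bx xb] [bz zb]; split=> w.
  have := jt_identity jt y x b z w.
  rewrite !bz (tp0r jt) subrr (jt_sym jt y) bx (tp0l jt) sub0r.
  by move=> /eqP; rewrite eq_sym oppr_eq0 => /eqP.
have := at_skew ja z b x y w.
by rewrite zb (tp0l jt) add0r bz (tp0m jt) add0r (jt_sym jt y) bx (tp0m jt).
Qed.

Lemma orth_tends b u x : (forall n, orth b (u n)) -> tends u x -> orth b x.
Proof.
move=> hu ux; split=> z.
  apply: (tends_uniq (tends_tp hE (tends_cst b) ux (tends_cst z))).
  have -> : (fun n => tp b (u n) z) = (fun=> 0) by apply/funext => n; have [-> _] := hu n.
  exact: tends_cst.
apply: (tends_uniq (tends_tp hE ux (tends_cst b) (tends_cst z))).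
have -> : (fun n => tp (u n) b z) = (fun=> 0) by apply/funext => n; have [_ ->] := hu n.
exact: tends_cst.
Qed.

(* The double orthogonal complement of e; it is an inner ideal. *)
Definition biorth e x := forall b, orth b e -> orth b x.

Lemma biorth_refl e : biorth e e.
Proof. by []. Qed.

Lemma biorth_trans e x y : biorth e x -> biorth x y -> biorth e y.
Proof. by move=> ex xy b /ex /xy. Qed.

Lemma biorthD e x y : biorth e x -> biorth e y -> biorth e (x + y).
Proof. by move=> ex ey b be; apply: orthD; [exact: ex | exact: ey]. Qed.

Lemma biorthZ e c x : biorth e x -> biorth e (c *: x).
Proof. by move=> ex b be; apply: orthZ; exact: ex. Qed.

Lemma biorth_tp e x y z : biorth e x -> biorth e z -> biorth e (tp x y z).
Proof. by move=> ex ez b be; apply: orth_tp; [exact: ex | exact: ez]. Qed.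

Lemma biorth_tends e u x : (forall n, biorth e (u n)) -> tends u x -> biorth e x.
Proof. by move=> eu ux b be; apply: (orth_tends _ ux) => n; exact: eu. Qed.

Lemma biorth_pev e a p : biorth e a -> biorth e (pev (tpow tp a) p).
Proof.
move=> ea; have ek k : biorth e (tpow tp a k).
  by elim: k => [|k IH] //=; exact: biorth_tp.
rewrite /pev; apply: (big_ind (biorth e)).
- by move=> b _; exact: orth0.
- by move=> x y; exact: biorthD.
- by move=> i _; exact: biorthZ.
Qed.

End Orthogonality.

(** Replacing v k by X^k reduces this to [ring]. In [selfadjoint_scalar] the vectors v 0, ..., v 5
    are h^3, p, d, e^3, h, e. *)
Lemma cubic_combination (R : realType) (V : lmodType R[i]) (v : nat -> V) (c0 c l : R) :
  (c0 + 3 * l ^+ 2 - c)%:C *: v 4 + (l ^+ 3 - c * l)%:C *: v 5 + l%:C *: v 1 =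
  v 0 + l%:C *: v 1 + (l ^+ 2)%:C *: v 2 + (l ^+ 3)%:C *: v 3 - c%:C *: (v 4 + l%:C *: v 5)
  - (v 0 - c0%:C *: v 4) - (l ^+ 2)%:C *: (v 2 - v 4 *+ 3) - (l ^+ 3)%:C *: (v 3 - v 5).
Proof.
have : (c0 + 3 * l ^+ 2 - c)%:C *: 'X^4 + (l ^+ 3 - c * l)%:C *: 'X^5 + l%:C *: 'X^1 =
    'X^0 + l%:C *: 'X^1 + (l ^+ 2)%:C *: 'X^2 + (l ^+ 3)%:C *: 'X^3
    - c%:C *: ('X^4 + l%:C *: 'X^5) - ('X^0 - c0%:C *: 'X^4)
    - (l ^+ 2)%:C *: ('X^2 - 'X^4 *+ 3) - (l ^+ 3)%:C *: ('X^3 - 'X^5) :> {poly R[i]}.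
  rewrite -!mul_polyC !(rmorphB, rmorphD, rmorphM, rmorphXn, rmorph_nat) /=; ring.
by move=> /(congr1 (pev v)); rewrite !(pevB, pevD, pevZ, pevMn) !pevXn.
Qed.

(** * The quadratic annihilator as a closed ideal *)

Section Derivation.
Variables (R : realType) (E X : completeNormedModType R[i]) (tp : E -> E -> E -> E).
Variables (m1 : X -> E -> E -> X) (m2 : E -> X -> E -> X) (m3 : E -> E -> X -> X).
Variable delta : E -> X.
Hypotheses (hE : JBstar_triple tp) (hX : banach_triple_module tp m1 m2 m3).
Hypothesis hd : triple_derivation tp m1 m2 m3 delta.

Let jt : jordan_triple tp := jbt_jordan (jbs_banach hE).
Let ja := tp_add_triple jt.
Let tm := btm_module hX.
Let dD := conj_linear_add (td_conj_linear hd).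
Let dZ := conj_linear_scaleR (td_conj_linear hd).
Let dder := td_derivation hd.
Local Notation sep := (separating_space delta).

Lemma module_bound : exists2 K : R, 0 < K &
  (forall a x b, nrm (m2 a x b) <= K * nrm a * nrm x * nrm b) /\
  (forall a b x, nrm (m3 a b x) <= K * nrm a * nrm b * nrm x).
Proof.
have [|||K2 K20 h2] := @trihomogeneous_bounded R _ _ _ _ m2 _ _ _ (btm_continuous2 hX).
- by move=> r a x b; exact: (conj_linear_scaleR (tm2_conj_a tm x b)).
- by move=> r a x b; exact: (conj_linear_scaleR (tm2_conj_x tm a b)).
- by move=> r a x b; exact: (conj_linear_scaleR (tm2_conj_b tm a x)).
have [|||K3 K30 h3] := @trihomogeneous_bounded R _ _ _ _ m3 _ _ _ (btm_continuous3 hX).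
- by move=> r a b x; exact: (conj_linear_scaleR (tm3_conj_a tm b x)).
- by move=> r a b x; exact: (linear_scaleR (tm3_linear_b tm a x)).
- by move=> r a b x; exact: (linear_scaleR (tm3_linear_x tm a b)).
exists (K2 + K3); first exact: addr_gt0.
split=> a b c.
  apply: le_trans (h2 a b c) _; rewrite -!mulrA ler_wpM2r ?mulr_ge0 ?nrm_ge0 //.
  by rewrite lerDl ltW.
apply: le_trans (h3 a b c) _; rewrite -!mulrA ler_wpM2r ?mulr_ge0 ?nrm_ge0 //.
by rewrite lerDr ltW.
Qed.

Lemma tends_m2 a b u x : tends u x -> tends (fun n => m2 a (u n) b) (m2 a x b).
Proof. by move=> h; apply: (tends_tri (btm_continuous2 hX)) => //; exact: tends_cst. Qed.

Lemma tends_m3m a u x b : tends u b -> tends (fun n => m3 a (u n) x) (m3 a b x).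
Proof. by move=> h; apply: (tends_tri (btm_continuous3 hX)) => //; exact: tends_cst. Qed.

Lemma dltQ a b : delta (tp a b a) = m3 a b (delta a) *+ 2 + m2 a (delta b) a.
Proof. by rewrite dder (tm_sym13 tm) mulr2n addrAC. Qed.

Lemma sep_m2 b s : sep s -> sep (m2 b s b).
Proof.
move=> /sepP[u u0 us]; apply/sepP; exists (fun n => tp b (u n) b).
  by have := tends_tp hE (tends_cst b) u0 (tends_cst b); rewrite (tp0m jt).
have -> : (fun n => delta (tp b (u n) b)) =
    (fun n => m3 b (u n) (delta b) *+ 2 + m2 b (delta (u n)) b).
  by apply/funext => n; rewrite dltQ.
rewrite -[m2 b s b]add0r; apply: tendsD; last exact: tends_m2.
have h := tends_m3m b (delta b) u0.
have h0 : m3 b 0 (delta b) = 0 by exact: (additive0 (fun a c => m3Dm tm b a c (delta b))).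
by have := tendsD h h; rewrite h0 addr0; congr tends; apply/funext => n; rewrite mulr2n.
Qed.

Let J := quad_annihilator m2 sep.
Hypothesis J_linear : linear_subspace J.
Hypothesis J_closed : closed J.
Hypothesis J_ann : forall a b x, J a -> J b -> sep x -> m3 a b x = 0.

Lemma J0 : J 0.
Proof. by case: J_linear => /set_mem. Qed.

Lemma J_lin c a b : J a -> J b -> J (c *: a + b).
Proof. by case: J_linear => _ h Ja Jb; apply/set_mem; apply: h; exact/mem_set. Qed.

Lemma JD a b : J a -> J b -> J (a + b).
Proof. by move=> Ja Jb; rewrite -[a]scale1r; exact: J_lin. Qed.

Lemma JZ c a : J a -> J (c *: a).
Proof. by move=> Ja; rewrite -[_ *: _]addr0; apply: J_lin => //; exact: J0. Qed.

Lemma JN a : J a -> J (- a).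
Proof. by rewrite -scaleN1r; exact: JZ. Qed.

Lemma JB a b : J a -> J b -> J (a - b).
Proof. by move=> Ja Jb; apply: JD => //; exact: JN. Qed.

Lemma J_tends u x : (forall n, J (u n)) -> tends u x -> J x.
Proof. exact: closed_tends. Qed.

Lemma J_approx x : (forall e : R, 0 < e -> exists2 y, J y & nrm (y - x) <= e) -> J x.
Proof.
move=> h; have h' n : exists y, J y /\ nrm (y - x) <= n.+1%:R^-1.
  by have [|y Jy hy] := h n.+1%:R^-1; [rewrite invr_gt0 | exists y].
have [u hu] := choice h'.
apply: (@J_tends u) => [n|]; first by have [] := hu n.
by apply: nrm_tends => n; have [] := hu n.
Qed.

Lemma J_half (z : E) : J (z *+ 2) -> J z.
Proof.
move=> h; rewrite (_ : z = 2^-1 *: (z *+ 2)); first exact: JZ.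
by rewrite -[z *+ 2]scaler_nat scalerA mulVf ?scale1r ?pnatr_eq0.
Qed.

Lemma tp_polar (a b c : E) :
  tp a b c *+ 2 = tp (a + c) b (a + c) - tp a b a - tp c b c.
Proof.
rewrite (tpDl jt) !(tpDr jt) (jt_sym jt c b a).
by rewrite [RHS](AC (2*2*1*1) ((2*3)*(1*5)*(4*6))) /= !subrr !addr0 mulr2n.
Qed.

(** Q(Q(d)a)s = Q(d)Q(a)Q(d)s, where Q(d)s is again in [sep]; polarisation then replaces d by two
    elements. *)
Lemma J_outer a b c : J a -> J (tp b a c).
Proof.
move=> Ja; have h d : J (tp d a d).
  move=> s ss; rewrite (m2_fundamental jt tm) (Ja _ (sep_m2 d ss)).
  exact: (m2_0m tm).
by apply: J_half; rewrite tp_polar; apply: JB; first exact: JB.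
Qed.

Lemma J_inner a b c : J a -> J c -> J (tp a b c).
Proof.
have h d : J d -> J (tp d b d).
  by move=> Jd s ss; rewrite (m2_fundamental jt tm) (Jd _ ss) !(m2_0m tm).
move=> Ja Jc; apply: J_half; rewrite tp_polar.
by apply: JB; [apply: JB|]; apply: h => //; exact: JD.
Qed.

Lemma J_tpow a k : J a -> J (tpow tp a k).
Proof. by elim: k => [|k IH] //= Ja; apply: J_inner => //; exact: IH. Qed.

Lemma J_tpowS a k : J (tp a a a) -> J (tpow tp a k.+1).
Proof.
move=> Ja; case: k => [//|k].
have -> : tpow tp a k.+2 = tp (tpow tp a 0) (tpow tp a 1) (tpow tp a k).
  by rewrite (tpow_assoc ja).
exact: J_outer.
Qed.

Lemma J_pev a p : (forall k, J (tpow tp a k)) -> J (pev (tpow tp a) p).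
Proof.
move=> Jk; rewrite /pev; apply: (big_ind J); [exact: J0 | exact: JD |].
by move=> i _; exact: JZ.
Qed.

Lemma scale_unit (a : E) : exists2 k : R, 0 < k & nrm (k%:C *: a) <= 1.
Proof.
have a1 : 0 < nrm a + 1 by have := nrm_ge0 a; lra.
exists (nrm a + 1)^-1; first by rewrite invr_gt0.
rewrite nrmZR gtr0_norm ?invr_gt0 // mulrC ler_pdivrMr // mul1r; lra.
Qed.

Lemma tp_scale3 (k : R) a : tp (k%:C *: a) (k%:C *: a) (k%:C *: a) = (k ^+ 3)%:C *: tp a a a.
Proof.
rewrite (tpZl jt) (tpZm jt) (tpZr jt) conj_realC !scalerA -!rmorphM /=.
by congr (_%:C *: _); ring.
Qed.

Lemma scaleK (V : lmodType R[i]) (k : R) (a : V) : k != 0 -> k^-1%:C *: (k%:C *: a) = a.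
Proof. by move=> k0; rewrite scalerA -rmorphM /= mulVf ?scale1r. Qed.

Lemma J_root a : J a -> exists2 c, J c & tp c c c = a.
Proof.
move=> Ja; have [k k0 ka] := scale_unit a.
have [c [u [ca uc _]]] := cube_root_pev hE ka.
have Jc : J c.
  apply: (J_tends _ uc) => n; apply: J_pev => l; apply: J_tpow; exact: JZ.
have [r r01] : exists r : R, r ^+ 3 = k^-1.
  exists (k^-1 `^ 3^-1); rewrite -powR_mulrn ?powR_ge0 // -powRrM mulVf ?powRr1 //.
  by rewrite invr_ge0 ltW.
exists (r%:C *: c); first exact: JZ.
by rewrite tp_scale3 r01 ca scaleK ?gt_eqF.
Qed.

Lemma J_unroot a : J (tp a a a) -> J a.
Proof.
move=> Ja; have [k k0 ka] := scale_unit a.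
have [c [u [_ _ ua]]] := cube_root_pev hE ka.
suff : J (k%:C *: a) by move=> h; rewrite -(@scaleK _ k a) ?gt_eqF //; exact: JZ.
have Jk : J (tp (k%:C *: a) (k%:C *: a) (k%:C *: a)) by rewrite tp_scale3; exact: JZ.
apply: (J_tends _ ua) => n.
rewrite (_ : rpoly ('X * u n ^+ 3) = 'X * rpoly (u n ^+ 3)); last first.
  by rewrite [LHS]rmorphM /= rpolyX.
rewrite (pevX jt) /pev (tp_sumr jt).
apply: (big_ind J); [exact: J0 | exact: JD |] => i _.
by rewrite (tpZr jt); apply: JZ; exact: (J_tpowS i Jk).
Qed.

(** So far only {E,J,E} and {J,E,J} are known to lie in [J]. For c = {d,d,d} with d in [J], all
    three terms of the main identity have one of these shapes. *)
Lemma J_ideal a b c : J c -> J (tp a b c).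
Proof.
move=> /J_root[d Jd <-]; rewrite (at_main ja).
apply: JD; last exact: J_outer.
by apply: JB; [exact: J_outer | exact: J_inner].
Qed.

Lemma J_idealC a b c : J a -> J (tp a b c).
Proof. by rewrite (jt_sym jt); exact: J_ideal. Qed.

(* Every x in J is a cube c^3 with c in J, and since J annihilates the separating space,
   each term of delta (c^3) only sees delta c modulo that space. *)
Lemma J_bounded : exists2 K : R, 0 < K & forall x, J x -> nrm (delta x) <= K * nrm x.
Proof.
have [K K0 [h2 h3]] := module_bound.
have [C C0 hC] := sep_bounded dD dZ.
exists (3 * K * C); first by rewrite !mulr_gt0.
move=> x /J_root[c Jc <-]; rewrite (jbs_cube hE) dltQ.
have [s ss hs] := hC c.
have -> : m3 c c (delta c) = m3 c c (delta c - s).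
  by rewrite -[in LHS](subrK s (delta c)) (m3Dr tm) (J_ann Jc Jc ss) addr0.
have -> : m2 c (delta c) c = m2 c (delta c - s) c.
  by rewrite -[in LHS](subrK s (delta c)) (m2Dm tm) (Jc _ ss) addr0.
have c0 := nrm_ge0 c.
have k3 := h3 c c (delta c - s); have k2 := h2 c (delta c - s) c.
have : K * nrm c * nrm c * nrm (delta c - s) <= K * nrm c * nrm c * (C * nrm c).
  by rewrite ler_wpM2l // !mulr_ge0 // ltW.
have := nrmD (m3 c c (delta c - s) *+ 2) (m2 c (delta c - s) c).
rewrite nrmMn.
have -> : 3 * K * C * nrm c ^+ 3 = 3 * (K * nrm c * nrm c * (C * nrm c)) by ring.
have k2' : nrm (m2 c (delta c - s) c) <= K * nrm c * nrm c * nrm (delta c - s).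
  by apply: le_trans k2 _; rewrite le_eqVlt; apply/orP; left; apply/eqP; ring.
lra.
Qed.

(** Along a null sequence whose images tend to s, the values Q(a)^2 delta u_n approach w != 0. A
    fixed multiple [M] of a late term is still small, and its value has norm at least M ||w||/2. *)
Lemma Q2_unbounded a s e B : sep s -> m2 a (m2 a s a) a != 0 -> 0 < e ->
  exists2 b, nrm b <= e & B <= nrm (m2 a (m2 a (delta b) a) a).
Proof.
move=> /sepP[u u0 us] ws e0; set w := m2 a (m2 a s a) a in ws.
have uw : tends (fun n => m2 a (m2 a (delta (u n)) a) a) w by do 2 apply: tends_m2.
have w0 : 0 < nrm w.
  by rewrite lt_def nrm_ge0 andbT; apply: contra ws => /eqP/nrm0_eq0 ->.
have w2 : 0 < nrm w / 2 by lra.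
pose M := Num.bound `|B / (nrm w / 2)|.
have MB : B <= M%:R * (nrm w / 2).
  rewrite -ler_pdivrMr //; apply: le_trans (ler_norm _) _.
  exact: (ltW (archi_boundP (normr_ge0 _))).
have M0 := ler0n R M.
have eM : 0 < e / (M%:R + 1) by rewrite divr_gt0 //; lra.
have [N1 h1] := u0 _ eM; have [N2 h2] := uw _ w2.
have {h1} := h1 _ (leq_maxl N1 N2); have {h2} := h2 _ (leq_maxr N1 N2).
move: (u _) => v; rewrite subr0 => h2 h1.
exists (M%:R%:C *: v).
  rewrite nrmZR normr_nat; move: h1; rewrite ltr_pdivlMr; last lra.
  by have := nrm_ge0 v; nra.
rewrite dZ !(conj_linear_scaleR (tm2_conj_x tm a a)) nrmZR normr_nat.
apply: le_trans MB _; rewrite ler_wpM2l //.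
by have := nrm_triangle (m2 a (m2 a (delta v) a) a) w 0; rewrite !subr0 nrm_distC; lra.
Qed.

(** If Q(a)^2 killed [sep], so would Q(a^3) = Q(a)^3, and [J_unroot] would put a into [J]. The
    square matches Q(a_n) x = Q(a_n)^2 b_n in the gliding hump. *)
Lemma Q2_nonzero a : ~ J a -> exists2 s, sep s & m2 a (m2 a s a) a != 0.
Proof.
move=> Ja; apply: contrapT => h; apply: Ja; apply: J_unroot => s ss.
rewrite (m2_fundamental jt tm) [X in m2 a X a](_ : _ = 0) ?(m2_0m tm) //.
by apply: contrapT => ns; apply: h; exists s => //; apply/eqP.
Qed.

(* Gliding hump: take b_n small with Q(a_n)^2 (delta b_n) huge and let x be the sum of
   the Q(a_n) b_n. Orthogonality gives Q(a_n) x = Q(a_n)^2 b_n for every n, and applying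
   delta shows that the Q(a_n)^2 (delta b_n) are controlled by delta x. *)
Lemma no_orth_sequence (a : nat -> E) :
  (forall n, ~ J (a n)) -> (forall n m, n != m -> orth tp (a n) (a m)) -> False.
Proof.
wlog a1 : a / forall n, nrm (a n) = 1.
  move=> wl Ja oa.
  have n0 n : nrm (a n) != 0 by apply/eqP => /nrm0_eq0 an; apply: (Ja n); rewrite an; exact: J0.
  apply: (wl (fun n => (nrm (a n))^-1%:C *: a n)) => [n|n|n m nm].
  - by rewrite nrmZR ger0_norm ?invr_ge0 ?nrm_ge0 // mulVf.
  - move=> /(JZ (nrm (a n))%:C); rewrite scalerA -rmorphM /= mulfV ?scale1r //.
    exact: Ja.
  - by apply: (orthZ hE); apply: orth_sym; apply: (orthZ hE); apply: orth_sym; exact: oa.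
move=> Ja oa.
have [Kt Kt0 ht] := jbs_bound hE; have [K K0 [h2 h3]] := module_bound.
pose D n := nrm (delta (a n)).
(* [Bd n] is the sum of the error terms below for ||delta x|| <= n, plus 1: 4KD from [p1] (as ||x||
   <= 2), Kn from [p2], 2KD from [p3], 2K^2 D from [p4]. *)
pose Bd n := K * (6 * D n + n%:R) + 2 * K * K * D n + 1.
have hb n : exists b, nrm b <= Num.min 1 (2^-1 ^+ n / Kt) /\ Bd n <= nrm (m2 (a n) (m2 (a n) (delta b) (a n)) (a n)).
  have [s ss s0] := Q2_nonzero (Ja n).
  have [|b b1 b2] := @Q2_unbounded (a n) s (Num.min 1 (2^-1 ^+ n / Kt)) (Bd n) ss s0.
    by rewrite lt_min ltr01 divr_gt0 // expV2_gt0.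
  by exists b.
have [b {}hb] := choice hb.
pose q n := tp (a n) (b n) (a n).
have b1 n : nrm (b n) <= 1 by have [] := hb n; rewrite le_min => /andP[].
have q1 n : nrm (q n) <= 2^-1 ^+ n.
  apply: le_trans (ht _ _ _) _; rewrite a1 !mulr1.
  by have [] := hb n; rewrite le_min ler_pdivlMr // mulrC => /andP[].
have [||x Sx hx] := @geometric_tends R E (fun n => \sum_(i < n) q i) 1.
- by [].
- by move=> n; rewrite big_ord_recr /= [X in nrm (X - _)]addrC addrK mul1r.
have x2 : nrm x <= 2 by have := hx 0%N; rewrite big_ord0 subr0; lra.
have Qx n : tp (a n) x (a n) = tp (a n) (q n) (a n).
  (* After the shift by [n.+1] every partial sum contains the index n, the only one that Q(a n) does
     not kill. *)
  apply: (tends_uniq (tends_shift n.+1 (tends_tp hE (tends_cst (a n)) Sx (tends_cst (a n))))).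
  have -> : (fun m => tp (a n) (\sum_(i < m + n.+1) q i) (a n)) = (fun=> tp (a n) (q n) (a n)).
    apply/funext => m; rewrite (tp_summ jt) -(big_mkord xpredT (fun i => tp (a n) (q i) (a n))).
    rewrite (bigD1_seq n) ?iota_uniq ?mem_index_iota //=; last by rewrite addnS ltnS leq_addl.
    rewrite big1 ?addr0 // => i ni.
    have [-> //] : orth tp (a n) (q i).
    by apply: (orth_tp hE); apply: oa; rewrite eq_sym.
  exact: tends_cst.
have [N hN] : exists N : nat, nrm (delta x) < N%:R.
  exists (Num.bound `|nrm (delta x)|); apply: le_lt_trans (ler_norm _) _.
  exact: (archi_boundP (normr_ge0 _)).
have := congr1 delta (Qx N); rewrite dltQ (dltQ _ (q N)) [delta (q N)]dltQ.
rewrite (m2Dm tm) [m3 (a N) (b N) _ *+ 2]mulr2n (m2Dm tm).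
set p1 := m3 _ x _; set p2 := m2 _ (delta x) _; set p3 := m3 _ (q N) _.
set p4 := m2 (a N) (m3 _ _ _) _; set p5 := m2 (a N) (m2 _ _ _) _ => pE.
have p5E : p5 = p1 *+ 2 + p2 - p3 *+ 2 - p4 *+ 2.
  rewrite pE -mulr2n; move: (p3 *+ 2) (p4 *+ 2) => x3 x4.
  by rewrite [RHS](AC (1*2*1*1) (3*(1*4)*(2*5))) /= !subrr !addr0.
have D0 := nrm_ge0 (delta (a N)).
have hp1 : nrm p1 <= K * (2 * D N).
  apply: le_trans (h3 _ _ _) _; rewrite a1 mulr1 -mulrA ler_pM2l // ler_wpM2r //.
have hp2 : nrm p2 <= K * nrm (delta x).
  by apply: le_trans (h2 _ _ _) _; rewrite a1 !mulr1.
have hp3 : nrm p3 <= K * D N.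
  apply: le_trans (h3 _ _ _) _; rewrite a1 mulr1 -mulrA ler_pM2l // ler_piMl //.
  by apply: le_trans (q1 N) _; rewrite exprn_ile1 ?invr_ge0 // invf_le1 ?ler1n.
have hp4 : nrm p4 <= K * (K * D N).
  apply: le_trans (h2 _ _ _) _; rewrite a1 !mulr1 ler_pM2l //.
  by apply: le_trans (h3 _ _ _) _; rewrite a1 mulr1 -mulrA ler_pM2l // ler_piMl.
have hp5 : nrm p5 <= 2 * nrm p1 + nrm p2 + 2 * nrm p3 + 2 * nrm p4.
  rewrite p5E; have := nrmB (p1 *+ 2 + p2 - p3 *+ 2) (p4 *+ 2).
  have := nrmB (p1 *+ 2 + p2) (p3 *+ 2); have := nrmD (p1 *+ 2) p2.
  rewrite !nrmMn; lra.
have [_] := hb N; rewrite -/p5 /Bd.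
have : K * nrm (delta x) <= K * N%:R by rewrite ler_pM2l // ltW.
have := mulr_ge0 (ltW K0) D0; rewrite -/(D N); lra.
Qed.

(** Otherwise one piece [f n] can be kept and the other split again, forever. Later pieces lie in
    the double complement of g (n+1), which is orthogonal to f n, so the kept pieces are pairwise
    orthogonal. *)
Lemma exists_nonsplit : (exists a, ~ J a) -> exists e, ~ J e /\
  forall f g, biorth tp e f -> biorth tp e g -> orth tp f g -> J f \/ J g.
Proof.
move=> [a0 Ja0]; apply: contrapT => h.
have hs e : exists fg : E * E, ~ J e -> [/\ biorth tp e fg.1, biorth tp e fg.2, orth tp fg.1 fg.2,
    ~ J fg.1 & ~ J fg.2].
  have [Je|Je] := pselect (J e); first by exists (0, 0).
  apply: contrapT => nfg; apply: h; exists e; split=> // f g ef eg fg.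
  apply: contrapT => /not_orP[nf ng]; apply: nfg; by exists (f, g).
have [F hF] := choice hs.
pose g n := iter n (fun e => (F e).2) a0; pose f n := (F (g n)).1.
have Jg n : ~ J (g n) by elim: n => //= n /hF[].
have hg n := hF _ (Jg n).
have gmono n m : biorth tp (g n) (g (n + m)%N).
  elim: m => [|m IH]; first by rewrite addn0.
  by rewrite addnS; apply: (biorth_trans IH); have [] := hg (n + m)%N.
have of_lt n m : (n < m)%N -> orth tp (f n) (f m).
  move=> nm; have [_ _ o _ _] := hg n; have [gf _ _ _ _] := hg m.
  have : biorth tp (g n.+1) (f m).
    by apply: biorth_trans gf; rewrite -(subnKC nm); exact: gmono.
  by apply.
apply: (@no_orth_sequence f) => [n|n m]; first by have [] := hg n.
by rewrite neq_ltn => /orP[/of_lt //|/of_lt/orth_sym].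
Qed.

(** * The inner ideal of an element that does not split modulo J *)

Section NonSplit.
Variable e0 : E.
Hypothesis e0_nonsplit :
  forall f g, biorth tp e0 f -> biorth tp e0 g -> orth tp f g -> J f \/ J g.

(* l is the threshold at which the parts of a^3 - l a lying over t^2 > l and t^2 < l
   pass from outside J into J. *)
Lemma nonsplit_cubic_unit a : biorth tp e0 a -> nrm a <= 1 ->
  exists2 l : R, 0 <= l & J (tp a a a - l%:C *: a).
Proof.
move=> ea a1; have [f [g [fg lip [f1 g0] fo fA]]] := spectral_split hE a1.
have i01 : 0 <= (1 : R) <= 1 by rewrite ler01 lexx.
have bio l : 0 <= l <= 1 -> biorth tp e0 (f l) /\ biorth tp e0 (g l).
  move=> l01; apply: (fA _ _ l01) => [u x|p]; first exact: biorth_tends.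
  exact: biorth_pev.
have dich l : 0 <= l <= 1 -> J (f l) \/ J (g l).
  move=> l01; have [bf bg] := bio l l01.
  have bf3 : biorth tp e0 (tp (f l) (f l) (f l)) by exact: biorth_tp.
  by have [/J_unroot|] := e0_nonsplit bf3 bg (fo l l01); [left | right].
pose S := [set l : R | 0 <= l <= 1 /\ J (f l)].
have S1 : S 1 by split=> //; rewrite f1; exact: J0.
have lS : lbound S 0 by move=> l [/andP[]].
have hS : has_inf S by split; [exists 1 | exists 0].
(* At the infimum [f] is in [J] by approximation from above, and [g] from below, where [dich] leaves
   only [g]. *)
set l0 := inf S.
have l00 : 0 <= l0 by apply: lb_le_inf => //; exists 1.
have l01 : l0 <= 1 by apply: ge_inf => //; exists 0.
have L01 : 0 <= l0 <= 1 by rewrite l00.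
have Jf : J (f l0).
  apply: J_approx => e e_gt0; have [l [l01' Jl] ll] := inf_adherent e_gt0 hS.
  exists (f l) => //; have [h _] := lip l l0 l01' L01; apply: le_trans h _.
  have : l0 <= l by apply: ge_inf; [exists 0 | split].
  rewrite -subr_ge0 => d; rewrite ger0_norm // lerBlDl; exact: ltW.
have Jg : J (g l0).
  have [->|l0n] := eqVneq l0 0; first by rewrite g0; exact: J0.
  have l0p : 0 < l0 by rewrite lt_def l0n.
  apply: J_approx => e e_gt0; pose d := Num.min e l0 / 2.
  have d0 : 0 < d by rewrite divr_gt0 // lt_min e_gt0.
  have de : d <= e.
    by rewrite ler_pdivrMr // ge_min; apply/orP; left; lra.
  have dl : d < l0.
    by rewrite ltr_pdivrMr // gt_min; apply/orP; right; lra.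
  have ld01 : 0 <= l0 - d <= 1 by apply/andP; split; lra.
  have [Jfl|Jgl] := dich _ ld01.
    have : l0 <= l0 - d by apply: ge_inf; [exists 0 | split].
    by move=> ll; exfalso; lra.
  exists (g (l0 - d)) => //; have [_ h] := lip _ _ ld01 L01; apply: le_trans h _.
  by rewrite addrAC subrr sub0r normrN gtr0_norm.
by exists l0 => //; rewrite -fg //; exact: JB.
Qed.

Lemma nonsplit_cubic x : biorth tp e0 x -> exists2 l : R, 0 <= l & J (tp x x x - l%:C *: x).
Proof.
move=> ex; have [k k0 kx] := scale_unit x.
have [|l l0 hl] := nonsplit_cubic_unit (a := k%:C *: x) _ kx; first exact: (biorthZ hE).
exists (l / k ^+ 2); first by rewrite divr_ge0 // exprn_ge0 // ltW.
rewrite (_ : _ - _ = ((k ^+ 3)^-1)%:C *: (tp (k%:C *: x) (k%:C *: x) (k%:C *: x) - l%:C *: (k%:C *: x))).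
  exact: JZ.
rewrite tp_scale3 scalerBr scaleK ?expf_neq0 ?gt_eqF // !scalerA -!rmorphM /=.
by congr (_ - _%:C *: _); field; rewrite gt_eqF.
Qed.

Lemma nonsplit_unit : ~ J e0 -> exists e, [/\ ~ J e, biorth tp e0 e & J (tp e e e - e)].
Proof.
move=> Je0; have [l l0 hl] := nonsplit_cubic (@biorth_refl _ _ tp e0).
have lp : 0 < l.
  rewrite lt_def l0 andbT; apply/eqP => lz; apply: Je0; apply: J_unroot.
  by move: hl; rewrite lz scale0r subr0.
pose k := (Num.sqrt l)^-1.
have s0 : 0 < Num.sqrt l by rewrite sqrtr_gt0.
have k0 : 0 < k by rewrite invr_gt0.
have kl : k ^+ 2 * l = 1 by rewrite exprVn sqr_sqrtr // mulVf // gt_eqF.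
exists (k%:C *: e0); split.
- by move=> /(JZ k^-1%:C); rewrite scaleK // gt_eqF.
- exact: (biorthZ hE).
- rewrite tp_scale3 (_ : _ - _ = (k ^+ 3)%:C *: (tp e0 e0 e0 - l%:C *: e0)); first exact: JZ.
  rewrite scalerBr scalerA -rmorphM /=; congr (_ - _%:C *: _).
  by rewrite exprSr mulrAC kl mul1r.
Qed.

Section Unit.
Variable e : E.
Hypotheses (Je : ~ J e) (e0e : biorth tp e0 e) (Jee : J (tp e e e - e)).

Lemma J_scale_e (c : R[i]) : J (c *: e) -> c = 0.
Proof.
move=> h; apply: contrapT => /eqP c0; apply: Je.
by rewrite -[e](scalerK c0); exact: JZ.
Qed.

(** Modulo [J], L(e,e)h = L(e,e)Q(e)h = {e^3,h,e} = Q(e)h = h. *)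
Lemma peirce2_box h : J (tp e h e - h) -> J (tp e e h - h).
Proof.
move=> hh; have E1 : tp e e (tp e h e) = tp (tp e e e) h e.
  by have [-> ->] := at_QL ja e e h.
have -> : tp e e h - h = (tp e h e - h) + tp (tp e e e - e) h e - tp e e (tp e h e - h).
  rewrite (tpDl jt) (tpNl jt) (tpDr jt) (tpNr jt) E1 opprB.
  by rewrite [RHS](AC (2*2*2) (5*2*(1*4)*(3*6))) /= !subrr !addr0.
by apply: JB; [apply: JD => //; exact: J_idealC | exact: J_ideal].
Qed.

(** Keeping only coefficients turns the elimination among congruences into real arithmetic. *)
Definition lin3 (p h : E) (c1 c2 c3 : R) := c1%:C *: h + c2%:C *: e + c3%:C *: p.

Lemma lin3Z p h k c1 c2 c3 : k%:C *: lin3 p h c1 c2 c3 = lin3 p h (k * c1) (k * c2) (k * c3).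
Proof. by rewrite /lin3 !scalerDr !scalerA -!rmorphM. Qed.

Lemma lin3D p h c1 c2 c3 d1 d2 d3 :
  lin3 p h c1 c2 c3 + lin3 p h d1 d2 d3 = lin3 p h (c1 + d1) (c2 + d2) (c3 + d3).
Proof.
rewrite /lin3 !rmorphD /= !scalerDl.
by rewrite [LHS](AC (3*3) (1*4*(2*5)*(3*6))).
Qed.

Lemma tp_cube_expand (h : E) (l : R) :
  tp (h + l%:C *: e) (h + l%:C *: e) (h + l%:C *: e) =
  tp h h h + l%:C *: (tp h h e + tp h e h + tp e h h) +
  (l ^+ 2)%:C *: (tp h e e + tp e h e + tp e e h) + (l ^+ 3)%:C *: tp e e e.
Proof.
rewrite (tpDl jt) !(tpDm jt) !(tpDr jt) !(tpZl jt) !(tpZm jt) !(tpZr jt) conj_realC.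
rewrite !scalerDr !scalerA -!rmorphM /= !expr2 exprS expr2 !mulrA.
by rewrite [LHS](AC (2*2*(2*2)) (1*(2*3*5)*(4*6*7)*8)) /=.
Qed.

(* Compare the cubic relations modulo J of h + l e for l = 1, -1, 2. *)
Lemma selfadjoint_scalar h : biorth tp e0 h -> J (tp e h e - h) ->
  exists r : R, J (h - r%:C *: e).
Proof.
move=> eh Jh; have JL := peirce2_box Jh.
pose p := tp h h e + tp h e h + tp e h h.
pose d := tp h e e + tp e h e + tp e e h.
have Jd : J (d - h *+ 3).
  have -> : d - h *+ 3 = (tp e e h - h) + (tp e h e - h) + (tp e e h - h).
    rewrite /d (jt_sym jt h e e) !mulrS mulr0n addr0 !opprD.
    by rewrite [LHS](AC (3*(1*2)) (1*4*(2*5)*(3*6))).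
  by apply: JD => //; exact: JD.
have [c0 _ hc0] := nonsplit_cubic eh.
(* The relations for h and e remove h^3 and e^3, and d = 3h modulo [J], so only h, e and p
   remain. *)
have key (l : R) : exists c : R, J (lin3 p h (c0 + 3 * l ^+ 2 - c) (l ^+ 3 - c * l) l).
  have [|c _ hc] := @nonsplit_cubic (h + l%:C *: e).
    by apply: (biorthD hE) => //; exact: (biorthZ hE).
  exists c; rewrite (_ : lin3 _ _ _ _ _ =
      (tp (h + l%:C *: e) (h + l%:C *: e) (h + l%:C *: e) - c%:C *: (h + l%:C *: e))
      - (tp h h h - c0%:C *: h) - (l ^+ 2)%:C *: (d - h *+ 3) - (l ^+ 3)%:C *: (tp e e e - e)).
    by do 3 ?[apply: JB] => //; exact: JZ.
  rewrite tp_cube_expand -/p -/d /lin3.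
  exact: (@cubic_combination R E (nth 0 [:: tp h h h; p; d; tp e e e; h; e])).
have [c1 k1] := key 1; have [cm km] := key (-1); have [c2 k2] := key 2.
have plane a b : J (lin3 p h a b 0) -> a = 0 -> b = 0.
  rewrite /lin3 => hab a0; move: hab; rewrite a0 !scale0r add0r addr0 => /J_scale_e.
  by move=> /complexI.
have solve a b : J (lin3 p h a b 0) -> a != 0 -> exists r : R, J (h - r%:C *: e).
  move=> hab a0; exists (- (b / a)).
  rewrite (_ : _ - _ = a^-1%:C *: lin3 p h a b 0); first exact: JZ.
  rewrite lin3Z /lin3 mulr0 scale0r addr0 mulVf // scale1r rmorphN scaleNr opprK.
  by rewrite mulrC.
have := JD k1 km; rewrite lin3D addrN.
set A := (X in lin3 _ _ X _ _); set B := (X in lin3 _ _ _ X _) => r1.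
have [A0|] := eqVneq A 0; last exact: solve r1.
have B0 := plane _ _ r1 A0.
have := JD (JZ (- 2)%:C k1) k2; rewrite lin3Z lin3D (_ : _ * _ + 2 = 0); last by ring.
set A' := (X in lin3 _ _ X _ _); set B' := (X in lin3 _ _ _ X _) => r2.
have [A0'|] := eqVneq A' 0; last exact: solve r2.
have B0' := plane _ _ r2 A0'.
(* A = B = 0 gives c1 = cm = c0 + 3, then A' = 0 gives c2 = c0 + 12, and B' becomes -12. *)
exfalso; move: A0 B0 A0' B0'; rewrite /A /B /A' /B'; lra.
Qed.

(* Q(e) b is split into its self-adjoint parts for the involution x |-> {e,x,e}. *)
Lemma Q_scalar b : exists c : R[i], J (tp e b e - c *: e).
Proof.
pose k := tp e b e; pose k' := tp e k e.
have Jk : J (tp e k' e - k).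
  (* Q(e)^3 b = Q(e^3) b, which is Q(e) b modulo [J]; thus Q(e) exchanges [k] and [k'] modulo
     [J]. *)
  have -> : tp e k' e = tp (tp e e e) b (tp e e e) by rewrite (at_fundamental ja).
  rewrite (_ : _ - _ = tp (tp e e e - e) b (tp e e e) + tp e b (tp e e e - e)).
    by apply: JD; [exact: J_idealC | exact: J_ideal].
  by rewrite (tpDl jt) (tpNl jt) (tpDr jt) (tpNr jt) addrA subrK.
have ek : biorth tp e0 k by exact: biorth_tp.
have ek' : biorth tp e0 k' by exact: biorth_tp.
have [|r1 h1] := @selfadjoint_scalar (k + k') (biorthD hE ek ek').
  rewrite (tpDm jt) -/k' (_ : _ - _ = tp e k' e - k) //.
  by rewrite opprD [LHS](AC (2*2) (2*3*(1*4))) /= subrr addr0.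
have [||r2 h2] := @selfadjoint_scalar ('i%R *: (k - k')).
- apply: (biorthZ hE); apply: (biorthD hE) => //.
  by rewrite -scaleN1r; exact: (biorthZ hE).
- rewrite (tpZm jt) conjCi (tpDm jt) (tpNm jt) -/k' scaleNr -scalerN -scalerBr opprB.
  by apply: JZ; rewrite opprB addrA subrK.
exists (2^-1 * (r1%:C - 'i%R * r2%:C)).
rewrite (_ : _ - _ = 2^-1 *: ((k + k' - r1%:C *: e) - 'i%R *: ('i%R *: (k - k') - r2%:C *: e))).
  by apply: JZ; apply: JB => //; exact: JZ.
have -> : 'i%R *: ('i%R *: (k - k') - r2%:C *: e) = - (k - k') - ('i%R * r2%:C) *: e.
  by rewrite scalerBr !scalerA -expr2 sqrCi scaleN1r.
have -> : k + k' - r1%:C *: e - (- (k - k') - ('i%R * r2%:C) *: e) =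
    k *+ 2 - (r1%:C - 'i%R * r2%:C) *: e.
  rewrite opprD !opprK scalerBl [in RHS]opprB mulr2n.
  by rewrite [LHS](AC (3*(2*1)) (1*4*(2*5)*(6*3))) /= subrr addr0.
by rewrite scalerBr scalerA -[k *+ 2]scaler_nat scalerA mulVf ?scale1r ?pnatr_eq0.
Qed.

(* The range of Q(e) lies in C e + J, so delta o Q(e) is bounded; hence so is
   Q(e) o delta, which puts e in J. *)
Lemma nonsplit_absurd : False.
Proof.
apply: Je => s /sepP[u u0 us].
have [K K0 hK] := J_bounded; have [Kt Kt0 ht] := jbs_bound hE.
(* The closed subspace [J] misses e, so it has a positive distance d from e, which controls the
   coefficient c in c e + j. *)
have [d d0 hdist] : exists2 d : R, 0 < d & forall c j, J j -> complex.Re `|c : R[i]| * d <= nrm (c *: e + j).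
  have [d d0 hd'] : exists2 d : R, 0 < d & forall j, J j -> d <= nrm (j - e).
    apply: contrapT => h; apply: Je; apply: J_approx => t t0.
    apply: contrapT => h'; apply: h; exists t => // j Jj.
    by rewrite leNgt; apply/negP => tj; apply: h'; exists j => //; exact: ltW.
  exists d => // c j Jj; have [->|c0] := eqVneq c 0.
    by rewrite normr0 mul0r nrm_ge0.
  have -> : c *: e + j = - (c *: (- (c^-1 *: j) - e)).
    by rewrite scalerDr !scalerN scalerA mulfV // scale1r opprD !opprK addrC.
  rewrite nrmN nrmZ ler_wpM2l //; last by apply: hd'; apply: JN; exact: JZ.
  by have := normr_ge0 c; rewrite lecE => /andP[].
(* With q = ||Q(e)v|| one has |c| <= q/d and ||j|| <= q + |c| ||e||, which gives the first factor;
   the second bounds Q(e). *)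
pose C := (K + (K * nrm e + nrm (delta e)) / d) * (Kt * nrm e * nrm e).
have dQ v : nrm (delta (tp e v e)) <= C * nrm v.
  have [c hc] := Q_scalar v; set j := _ - _ in hc.
  have E1 : tp e v e = c *: e + j by rewrite /j addrC subrK.
  have c0 : 0 <= complex.Re `|c| by have := normr_ge0 c; rewrite lecE => /andP[].
  have := hdist c j hc; rewrite -E1 -ler_pdivlMr // => cb.
  have cn : complex.Re `|Num.conj c| = complex.Re `|c| by rewrite norm_conjC.
  rewrite {1}E1 dD (conj_linearZ (td_conj_linear hd)).
  apply: le_trans (nrmD _ _) _; rewrite nrmZ cn.
  have jb : nrm j <= nrm (tp e v e) + complex.Re `|c| * nrm e.
    by rewrite /j; apply: le_trans (nrmB _ _) _; rewrite nrmZ.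
  have kj := hK _ hc.
  have e_0 := nrm_ge0 e; have de0 := nrm_ge0 (delta e).
  have q0 := nrm_ge0 (tp e v e).
  apply: (@le_trans _ _ ((K + (K * nrm e + nrm (delta e)) / d) * nrm (tp e v e))).
    have : complex.Re `|c| * (K * nrm e + nrm (delta e)) <=
        nrm (tp e v e) / d * (K * nrm e + nrm (delta e)).
      by rewrite ler_wpM2r // addr_ge0 // mulr_ge0 // ltW.
    have : K * nrm j <= K * (nrm (tp e v e) + complex.Re `|c| * nrm e) by rewrite ler_pM2l.
    move: (nrm (tp e v e)) (complex.Re _) (nrm e) (nrm (delta e)) cb kj => q t y z cb kj h1 h2.
    rewrite (_ : (K + (K * y + z) / d) * q = K * q + q / d * (K * y + z)); last by ring.
    lra.
  rewrite /C -mulrA ler_wpM2l //.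
    by rewrite addr_ge0 ?divr_ge0 ?addr_ge0 ?mulr_ge0 // ltW.
  by apply: le_trans (ht _ _ _) _; rewrite le_eqVlt; apply/orP; left; apply/eqP; ring.
have dQ0 : tends (fun n => delta (tp e (u n) e)) 0.
  move=> t t0; have C0 : 0 < `|C| + 1 by have := normr_ge0 C; lra.
  have [N hN] := u0 _ (divr_gt0 t0 C0); exists N => n /hN.
  rewrite !subr0 ltr_pdivlMr // => hn; apply: le_lt_trans (dQ _) _.
  by apply: le_lt_trans hn; have := nrm_ge0 (u n); have := ler_norm C; nra.
have h3 := tends_m3m e (delta e) u0.
have h30 : m3 e 0 (delta e) = 0 by exact: (additive0 (fun a c => m3Dm tm e a c (delta e))).
have := tendsB (tendsB dQ0 h3) h3; rewrite h30 !subr0 => h.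
apply: (tends_uniq (tends_m2 e e us)); move: h; congr tends.
by apply/funext => n; rewrite dltQ mulr2n [LHS](AC (3*1*1) (3*(1*4)*(2*5))) /= !subrr !addr0.
Qed.

End Unit.
End NonSplit.

Lemma J_full x : J x.
Proof.
apply: contrapT => Jx; have [|e0 [Je0 he0]] := exists_nonsplit; first by exists x.
have [e [Je e0e Jee]] := nonsplit_unit he0 Je0.
exact: (nonsplit_absurd he0 Je e0e Jee).
Qed.

Lemma derivation_continuous : continuous delta.
Proof.
have [K K0 hK] := J_bounded.
apply: (@additive_bounded_continuous R E X delta K) => [x y|x].
  by rewrite (dltB dD dZ).
exact: hK (J_full x).
Qed.

End Derivation.

Local Close Scope complex_scope.

Theorem theorem13 (R : realType) (E X : completeNormedModType R[i])
    (tp : E -> E -> E -> E)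
    (m1 : X -> E -> E -> X) (m2 : E -> X -> E -> X) (m3 : E -> E -> X -> X)
    (delta : E -> X)
    (hE : JBstar_triple tp)
    (hX : banach_triple_module tp m1 m2 m3)
    (hdelta : triple_derivation tp m1 m2 m3 delta) :
  continuous delta <->
  [/\ linear_subspace (quad_annihilator m2 (separating_space delta)),
      closed (quad_annihilator m2 (separating_space delta)) &
      forall a b x,
        quad_annihilator m2 (separating_space delta) a ->
        quad_annihilator m2 (separating_space delta) b ->
        separating_space delta x ->
        split_null_ext tp m1 m2 m3 (a, 0) (b, 0) (0, x) = 0].
Proof.
have jt := jbt_jordan (jbs_banach hE); have tm := btm_module hX.
have splitE a b x : split_null_ext tp m1 m2 m3 (a, 0) (b, 0) (0, x) = (0, m3 a b x).
  by rewrite /split_null_ext /= (tp0r jt) (m1_0l tm) (m2_0m tm) !add0r.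
split=> [cd|[Jl Jc Ja]].
  have sep0E x : separating_space delta x -> x = 0.
    move=> /sepP[u u0 ux]; apply: (tends_uniq ux).
    rewrite -(additive0 (conj_linear_add (td_conj_linear hdelta))).
    exact: (continuous_tends (cd 0) u0).
  have JT : quad_annihilator m2 (separating_space delta) = setT.
    by apply/seteqP; split=> // a _ s /sep0E ->; exact: (m2_0m tm).
  split; rewrite ?JT; [|exact: closedT|].
    by split=> [|c a b _ _]; rewrite inE.
  by move=> a b x _ _ /sep0E ->; rewrite splitE (m3_0r tm).
apply: (derivation_continuous hE hX hdelta Jl Jc) => a b x ha hb hx.
by have := Ja a b x ha hb hx; rewrite splitE => -[].
Qed.
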